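(* Let $F$ be a finite connected graph, and let $I\subseteq V(F)$ be a non-empty doubly independent set. Then \[\rho(\omega\cdot F)\geq f\left(\frac{|N(I)|}{|I|}\right).\]
   Context: For a finite graph $F$, $\omega\cdot F$ denotes the disjoint union of a countably infinite number of copies of $F$. For a set $S$ of vertices of a graph, $N(S)=\left(\bigcup_{v\in S}N(v)\right)\setminus S$ is the set of vertices outside $S$ with a neighbor in $S$. A set $I$ of vertices is doubly independent if both $I$ and $N(I)$ are independent sets. Let $K_{\mathbb{N}}$ be the complete graph on the natural numbers $\mathbb{N}=\{1,2,\dots\}$, and $[n]=\{1,\dots,n\}$. For $S\subseteq\mathbb{N}$ the (upper) density is $\bar d(S)=\limsup_{n\to\infty}|S\cap[n]|/n$, and for a subgraph $H'\subseteq K_{\mathbb{N}}$ we set $\bar d(H')=\bar d(V(H'))$. For a countably infinite graph $H$ (vertex set of the same cardinality as $\mathbb{N}$), the Ramsey upper density $\rho(H)$ is the supremum of the values $\lambda$ for which, for every two-coloring of $E(K_{\mathbb{N}})$, there exists a monochromatic (not necessarily induced) subgraph $H'\subseteq K_{\mathbb{N}}$, isomorphic to $H$, with $\bar d(H')\geq\lambda$. Definition of $f:[0,+\infty]\to\mathbb{R}$. Let $\gamma\in(-1,1)$. For a continuous $g:[0,+\infty)\to\mathbb{R}$ let $\Gamma^+_\gamma(g,t)=\min\{x:\gamma x+g(x)\geq t\}$ and $\Gamma^-_\gamma(g,t)=\min\{x:\gamma x-g(x)\geq t\}$, the minimum of the empty set being $+\infty$. Let $h(\gamma)=\inf_g\limsup_{t\to\infty}\frac{\Gamma^+_\gamma(g,t)+\Gamma^-_\gamma(g,t)}{t}$,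 the infimum being over all 1-Lipschitz functions $g:[0,+\infty)\to\mathbb{R}$ with $g(0)=0$ (1-Lipschitz: $|g(x)-g(y)|\leq|x-y|$ for all $x,y$). For $\lambda\in(0,+\infty)$ set \[f(\lambda)=1-\frac{1}{\frac{2\lambda}{(1+\lambda)^2}h\left(\frac{\lambda-1}{\lambda+1}\right)+\frac{2\lambda}{1+\lambda}},\] and $f(0)=1$, $f(+\infty)=1/2$. *)

(* Defs.v *)
From HB Require Import structures.
From mathcomp Require Import all_boot all_order all_algebra.

Set Implicit Arguments.
Unset Strict Implicit.
Unset Printing Implicit Defensive.

Record sgraph (T : Type) := SGraph {
  adj : rel T;
  adj_sym : symmetric adj;
  adj_irrefl : irreflexive adj }.

Section FiniteGraphs.
Context (V : finType) (F : sgraph V).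
Implicit Types S I : {set V}.

Definition connected_graph := forall u v : V, connect (adj F) u v.

Definition nbhd S : {set V} :=
  (\bigcup_(v in S) [set u | adj F v u]) :\: S.

Definition independent S :=
  forall u v : V, u \in S -> v \in S -> ~~ adj F u v.

Definition doubly_independent I := independent I /\ independent (nbhd I).

End FiniteGraphs.

Section OmegaCopies.
Context (T : Type) (F : sgraph T).

Definition copies_adj : rel (nat * T) :=
  fun p q => (p.1 == q.1) && adj F p.2 q.2.

Lemma copies_adj_sym : symmetric copies_adj.
Proof. by move=> p q; rewrite /copies_adj eq_sym adj_sym. Qed.

Lemma copies_adj_irrefl : irreflexive copies_adj.
Proof. by move=> p; rewrite /copies_adj adj_irrefl andbF. Qed.

Definition omega_copies : sgraph (nat * T) :=
  SGraph copies_adj_sym copies_adj_irrefl.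

End OmegaCopies.

From mathcomp Require Import all_classical all_reals all_analysis.
From mathcomp Require Import ring lra.
Import Order.TTheory GRing.Theory Num.Theory numFieldNormedType.Exports.
Local Open Scope classical_set_scope.
Local Open Scope ring_scope.

(* The vertices of the complete graph K_N are the positive integers, as a
   subset of nat; [sub_edge] is empty outside [sub_vert]. *)
Record subgraphKN := SubgraphKN {
  sub_vert : set nat;
  sub_edge : rel nat;
  sub_vert_gt0 : forall x, sub_vert x -> (0 < x)%N;
  sub_edge_sym : symmetric sub_edge;
  sub_edge_irrefl : irreflexive sub_edge;
  sub_edge_vert : forall x y, sub_edge x y -> sub_vert x }.

Definition isomorphic_to (T : Type) (H : sgraph T) (K : subgraphKN) :=
  exists phi : T -> nat,
    set_bij setT (sub_vert K) phi /\
    forall u v, sub_edge K (phi u) (phi v) = adj H u v.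

(* A two-coloring of the edges of K_N is a symmetric [c : rel nat]; its values
   on the diagonal and at 0 play no role. *)
Definition monochromatic (c : rel nat) (K : subgraphKN) :=
  exists b : bool, forall x y, sub_edge K x y -> c x y = b.

Section Densities.
Context (R : realType).

Definition upper_density (S : set nat) : \bar R :=
  limn_esup (fun n : nat => ((count (mem S) (iota 1 n))%:R / n%:R : R)%:E).

Definition ramsey_upper_density (T : Type) (H : sgraph T) : \bar R :=
  ereal_sup [set l%:E | l in [set l : R |
    forall c : rel nat, symmetric c ->
      exists K : subgraphKN, [/\ monochromatic c K, isomorphic_to H K &
        (l%:E <= upper_density (sub_vert K))%E]]].

(* The infimum is a minimum when the set is nonempty (Gamma_plus_min and
   Gamma_minus_min below), and +oo when it is empty. *)
Definition Gamma_plus (gamma : R) (g : R -> R) (t : R) : \bar R :=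
  ereal_inf [set x%:E | x in [set x : R | 0 <= x /\ t <= gamma * x + g x]].

Definition Gamma_minus (gamma : R) (g : R -> R) (t : R) : \bar R :=
  ereal_inf [set x%:E | x in [set x : R | 0 <= x /\ t <= gamma * x - g x]].

(* Only the restriction of g to [0, +oo[ matters. *)
Definition h_ereal (gamma : R) : \bar R :=
  ereal_inf [set limf_esup
      (fun t : R => (Gamma_plus gamma g t + Gamma_minus gamma g t) * (t^-1)%:E)%E
      (pinfty_nbhs R)
    | g in [set g : R -> R | 1.-lipschitz_(`[0, +oo[) g /\ g 0 = 0]].

(* [h_ereal gamma] is finite for -1 < gamma < 1 (h_ereal_fin_num below). *)
Definition h (gamma : R) : R := fine (h_ereal gamma).

Definition f (x : \bar R) : R :=
  match x with
  | l%:E => if l == 0 then 1 else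
      1 - 1 / (2 * l / (1 + l) ^+ 2 * h ((l - 1) / (l + 1)) + 2 * l / (1 + l))
  | +oo%E => 1 / 2
  | -oo%E => 0 (* outside the domain [0, +oo] *)
  end.

End Densities.

Lemma itv0_lipschitzP (R : realType) (g : R -> R) :
  1.-lipschitz_(`[0, +oo[) g <->
  forall x y, 0 <= x -> 0 <= y -> `|g x - g y| <= `|x - y|.
Proof.
split=> [H x y x0 y0|H [x y] [/=]].
  by have := H (x, y); rewrite /= mul1r; apply; split; rewrite /= in_itv/= andbT.
by rewrite !in_itv/= !andbT mul1r; exact: H.
Qed.

Section GammaAttained.
Context (R : realType) (gamma : R).

Let ereal_inf_attained (p : R -> R) (t : R) :
  (forall x y, 0 <= x -> 0 <= y -> p x - p y <= (`|gamma| + 1) * `|x - y|) ->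
  [set x : R | 0 <= x /\ t <= p x] !=set0 ->
  exists2 x, 0 <= x /\ t <= p x &
    ereal_inf [set x%:E | x in [set x : R | 0 <= x /\ t <= p x]] = x%:E.
Proof.
set A := [set x : R | _] => plip A0; pose m := inf A.
have lA : lbound A 0 by move=> x [].
have hA : has_inf A by split => //; exists 0.
have m0 : 0 <= m by apply: lb_le_inf.
have C0 : 0 < `|gamma| + 1 by rewrite ltr_wpDl.
have Am : A m.
  split => //; apply/ler_addgt0Pr => e e0.
  have CV : 0 < e / (`|gamma| + 1) by rewrite divr_gt0.
  have [x [x0 tx] xm] := inf_adherent CV hA.
  have mx : m <= x by apply: ge_inf => //; exists 0.
  apply: (le_trans tx); rewrite -lerBlDl; apply: (le_trans (plip _ _ x0 m0)).
  rewrite [`|x - m|]ger0_norm ?subr_ge0// mulrC -ler_pdivlMr// lerBlDl.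
  exact: ltW.
by exists m => //; rewrite ereal_inf_EFin//; exists 0.
Qed.

Lemma Gamma_plus_min (g : R -> R) (t : R) :
  1.-lipschitz_(`[0, +oo[) g ->
  (exists2 x, 0 <= x & t <= gamma * x + g x) ->
  exists2 x, 0 <= x /\ t <= gamma * x + g x & Gamma_plus gamma g t = x%:E.
Proof.
move=> /itv0_lipschitzP lipg [z z0 tz].
apply: (@ereal_inf_attained (fun x => gamma * x + g x)); last by exists z.
move=> x y x0 y0; rewrite opprD addrACA -mulrBr mulrDl mul1r lerD//.
  by rewrite -normrM ler_norm.
by apply: le_trans (lipg _ _ x0 y0); exact: ler_norm.
Qed.

Lemma Gamma_minus_min (g : R -> R) (t : R) :
  1.-lipschitz_(`[0, +oo[) g ->
  (exists2 x, 0 <= x & t <= gamma * x - g x) ->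
  exists2 x, 0 <= x /\ t <= gamma * x - g x & Gamma_minus gamma g t = x%:E.
Proof.
move=> /itv0_lipschitzP lipg [z z0 tz].
apply: (@ereal_inf_attained (fun x => gamma * x - g x)); last by exists z.
move=> x y x0 y0; rewrite opprD addrACA -mulrBr mulrDl mul1r lerD//.
  by rewrite -normrM ler_norm.
by rewrite -opprD; apply: le_trans (lipg _ _ x0 y0); rewrite -normrN ler_norm.
Qed.

End GammaAttained.

Section Finiteness.
(* Any gamma in (-1, 1) admits the test function g x = c x cos (b ln x). *)
Context (R : realType) (gamma : R).
Hypothesis gN1 : -1 < gamma.
Hypothesis g1 : gamma < 1.
Let c : R := (1 + `|gamma|) / 2.
Let d : R := (1 - `|gamma|) / 2.
Let b : R := (1 - c) / c.
Let ab : `|gamma| < 1. Proof. by rewrite ltr_norml gN1 g1. Qed.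
Let c0 : 0 < c. Proof. rewrite /c; have := normr_ge0 gamma; lra. Qed.
Let d0 : 0 < d. Proof. rewrite /d; have := ab; lra. Qed.
Let b0 : 0 < b. Proof. rewrite /b divr_gt0// /c; have := ab; lra. Qed.
Let cb : c * (1 + b) = 1. Proof. by rewrite /b; field; rewrite gt_eqF. Qed.
Let g (x : R) : R := c * x * cos (b * ln x).

Let gd (x : R) : 0 < x -> is_derive x 1 g (c * cos (b * ln x) - c * b * sin (b * ln x)).
Proof.
move=> x0; have H := is_derive1_ln x0.
rewrite /g; apply: is_derive_eq.
rewrite /GRing.scale /=. field. by rewrite gt_eqF.
Qed.

Let glip : 1.-lipschitz_(`[0, +oo[) g.
Proof.
have G0 (y : R) : `|g y| <= `|y|.
  rewrite /g (normrM (c * y)) (normrM c) (gtr0_norm c0) mulrAC -[leRHS]mul1r ler_wpM2r//.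
  have := cos_max (b * ln y); have c1 : c <= 1 by rewrite /c; have := ab; lra.
  move=> ?; rewrite mulr_ile1//; exact: ltW.
have H (x y : R) : 0 <= x -> x < y -> `|g x - g y| <= `|x - y|.
  rewrite le_eqVlt => /predU1P[<-|x0] xy.
    by rewrite [X in X - _]/g mulr0 mul0r !sub0r !normrN.
  have D (z : R) : z \in `]x, y[ -> is_derive z 1 g (c * cos (b * ln z) - c * b * sin (b * ln z)).
    rewrite in_itv/= => /andP[xz _]; apply: gd; exact: lt_trans xz.
  have [|z _ E] := MVT xy D.
    apply: derivable_within_continuous => z; rewrite in_itv/= => /andP[xz _].
    by have [] := gd (lt_le_trans x0 xz).
  rewrite distrC E normrM -[leRHS]mul1r [`|x - y|]distrC ler_wpM2r// -cb.
  apply: (le_trans (ler_normB _ _)); rewrite (normrM c) (normrM (c * b)) (normrM c) (gtr0_norm c0) (gtr0_norm b0).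
  have := cos_max (b * ln z); have := sin_max (b * ln z) => s1 s2.
  have cb0 : 0 <= c * b by rewrite mulr_ge0 // ltW.
  by rewrite [c * (1 + b)]mulrDr mulr1; apply: lerD; [apply: (ler_piMr (ltW c0))|apply: (ler_piMr cb0)].
move=> [x y] [/=]; rewrite !in_itv/= !andbT mul1r => x0 y0.
have [xy|yx|->] := ltgtP x y; first exact: H.
  by rewrite distrC [leRHS]distrC; exact: H.
by rewrite !subrr.
Qed.

Let T : R := pi *+ 2.
Let T0 : 0 < T. Proof. by rewrite /T mulr2n addr_gt0 ?pi_gt0. Qed.
Let M := expR (2 * T / b).

Let phase (th s : R) : 0 <= th <= T -> 1 <= s ->
  exists2 x : R, s <= x <= M * s & cos (b * ln x) = cos th.
Proof.
move=> /andP[th0 thT] s1; have s0 : 0 < s by lra.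
pose N := Num.truncn (b * ln s / T).
have q0 : 0 <= b * ln s / T by rewrite divr_ge0 ?(ltW T0) ?(mulr_ge0 (ltW b0) (ln_ge0 s1)).
have Eb : b != 0 by rewrite gt_eqF.
have bp := b0. have Tp := T0. clearbody b.
have /andP[k1 k2] := truncn_itv q0.
exists (expR ((th + T *+ N.+1) / b)); last first.
  rewrite expRK mulrC divfK ?gt_eqF//; apply: periodicn; exact: cosD2pi.
have Es : s = expR (ln s) by rewrite lnK ?posrE.
move: k1 k2; rewrite -/N ler_pdivlMr // ltr_pdivrMr // -natr1 => k1 k2.
rewrite -[T *+ _]mulr_natl -natr1 /M Es -expRD !ler_expR.
rewrite ler_pdivlMr // ler_pdivrMr // (mulrDl _ _ b) divfK ?Eb//.
move: k1 k2; move: (_%:R : R) => q k1 k2.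
by apply/andP; split; lra.
Qed.

Let GP t : d <= t -> (Gamma_plus gamma g t <= (M * (t / d))%:E)%E.
Proof.
move=> dt; have s1 : 1 <= t / d by rewrite ler_pdivlMr // mul1r.
have [|x /andP[x1 x2] xc] := @phase 0 _ _ s1.
  by rewrite lexx ltW.
have x0 : 0 <= x by lra.
apply: (@le_trans _ _ x%:E); last by rewrite lee_fin.
apply: ereal_inf_lbound; exists x => //; split => //.
rewrite /g xc cos0 mulr1; move: x1; rewrite ler_pdivrMr // => /le_trans; apply.
rewrite -mulrDl mulrC ler_wpM2r//.
have := ler_norm (- gamma); rewrite normrN /c /d; lra.
Qed.

Let GM t : d <= t -> (Gamma_minus gamma g t <= (M * (t / d))%:E)%E.
Proof.
move=> dt; have s1 : 1 <= t / d by rewrite ler_pdivlMr // mul1r.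
have [|x /andP[x1 x2] xc] := @phase pi _ _ s1.
  by rewrite /T mulr2n; have := @pi_ge0 R; lra.
have x0 : 0 <= x by lra.
apply: (@le_trans _ _ x%:E); last by rewrite lee_fin.
apply: ereal_inf_lbound; exists x => //; split => //.
rewrite /g xc cospi mulrN1 opprK; move: x1; rewrite ler_pdivrMr // => /le_trans; apply.
rewrite -mulrDl mulrC ler_wpM2r//.
have := ler_norm (- gamma); rewrite normrN /c /d; lra.
Qed.

Lemma Gamma_ge0 g' t : (0 <= Gamma_plus gamma g' t)%E /\ (0 <= Gamma_minus gamma g' t)%E.
Proof. by split; apply: le_ereal_inf_tmp => _ [x [x0 _] <-]; rewrite lee_fin. Qed.

Lemma h_ereal_fin_num : h_ereal gamma \is a fin_num.
Proof.
rewrite ge0_fin_numE.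
  apply: (@le_lt_trans _ _ (2 * M / d)%:E); last exact: ltry.
  apply: ge_ereal_inf; exists (limf_esup
      (fun t : R => (Gamma_plus gamma g t + Gamma_minus gamma g t) * (t^-1)%:E)%E
      (pinfty_nbhs R)).
    by exists g => //; split; [exact: glip | rewrite /g mulr0 mul0r].
  apply: ge_ereal_inf; eexists; first by exists [set t | d < t] => //; exists d; split => //; exact: num_real.
  apply: ge_ereal_sup => _ [t /= dt <-].
  have t0 : 0 < t by apply: lt_trans dt.
  rewrite lee_pdivrMr // -EFinM.
  apply: (le_trans (leeD (GP (ltW dt)) (GM (ltW dt)))).
  by rewrite -EFinD lee_fin le_eqVlt; apply/orP; left; apply/eqP; field; rewrite gt_eqF.
apply: le_ereal_inf_tmp => _ [g' _ <-].
apply: le_ereal_inf_tmp => _ [V [A [_ AV]] <-].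
pose t := `|A| + 1.
apply: (@le_trans _ _ ((Gamma_plus gamma g' t + Gamma_minus gamma g' t) * (t^-1)%:E)%E).
  have [? ?] := Gamma_ge0 g' t.
  by rewrite mule_ge0 ?adde_ge0// lee_fin invr_ge0 /t addr_ge0.
apply: ereal_sup_ubound; exists t => //; apply: AV.
by rewrite /t; have := ler_norm A; lra.
Qed.
End Finiteness.

(* Main.v *)
Require Import Defs.
From mathcomp Require Import all_boot all_order all_algebra.
From mathcomp Require Import all_classical all_reals all_analysis.
From mathcomp Require Import zify ring lra.
Import Order.TTheory GRing.Theory Num.Theory numFieldNormedType.Exports.
Set Implicit Arguments.
Unset Strict Implicit.
Unset Printing Implicit Defensive.
Local Open Scope ring_scope.

(** Let [a = #|I|], [b = #|nbhd F I|], [lam = b / a], and fix a two-coloring.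

    Classes.  Up to finitely many exceptions, the vertices split into finitely
    many classes, each with a color, such that every finite part of a class is
    joined, arbitrarily far out, to a clique of [#|V|] vertices, all these edges
    having the color of the class ([vertex_classes]).  Call a vertex red or blue
    after its class.  A red vertex extends to a red copy of [F].  So does a red
    complete bipartite graph [K_{b,a}] whose side of size [b] lies in one red
    class: it receives [nbhd F I] on that side and [I] on the other, double
    independence leaves no edge inside a side, and the remaining vertices of [F]
    have neighbors in [nbhd F I] only, so the far away clique can receive them.
    Hence red copies cover all red vertices, together with as many blue ones as
    disjoint red [K_{b,a}] can cover; and symmetrically.  It is enough to find,
    for every [kappa > 1 - f lam], infinitely many [n] for which one of the two
    colors leaves at most [kappa * n] vertices of [[1, n]] uncovered:
    [copies_from_tiling] and [copies_assembled] then build the copy of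
    [omega_copies F].

    Cuts.  If disjoint red [K_{b,a}] leave more than [kappa * n] blue vertices
    of [[1, n]] uncovered, then duality ([tiling_alternative]) provides a finite
    set [U] of red vertices and a set [Q] of blue vertices of [[1, n]] with
    [#|Q| - #|U| / lam] at least about [kappa * n], and no large red complete
    bipartite graph between [Q] and the red vertices outside [U].  If blue fails
    at [m], there is a similar pair [(U', Q')] with the colors exchanged.  A
    large part of [Q'] outside [U] and a large part of [Q] outside [U'] would
    contain a monochromatic complete bipartite graph, which one of the cuts
    forbids: up to a constant, [#|Q'| <= #|U|] or [#|Q| <= #|U'|]
    ([block_free_cross]).

    Staircase.  Suppose both colors fail for all large [n].  In the quarter
    plane, the points [(#|U|, #|Q|)] of the red cuts and [(#|Q'|, #|U'|)] of the
    blue ones are then separated by a monotone path from the origin.  Let [g] be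
    the difference of the two coordinates along the path, as a function of their
    sum; it is 1-Lipschitz.  The two linear forms in the definition of [h] are
    proportional to the excesses [u - v / lam] and [v - u / lam], so every cut
    bounds one of [Gamma_plus] and [Gamma_minus].  As the red and the blue
    vertices of [[1, n]] are at most [n] altogether, the two bounds add up to an
    upper bound on [h] ([staircase_bound]) which says exactly that
    [kappa <= 1 - f lam].  Hence some color succeeds infinitely often. *)

(** * Hall's theorem and a bipartite Ramsey lemma *)

Section Hall.
Local Open Scope nat_scope.
Context (D T : finType).
Implicit Types (A : D -> {set T}) (S : {set D}).

Definition hall_condition A := forall S, #|S| <= #|\bigcup_(i in S) A i|.

Definition shrink A i x := fun j => if j == i then A i :\ x else A j.

Lemma shrink_cover A i x S : i \notin S ->
  \bigcup_(j in i |: S) shrink A i x j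
    = (A i :\ x) :|: \bigcup_(j in S) A j.
Proof.
move=> iS; rewrite finset.bigcup_setU big_set1 /shrink eqxx; congr (_ :|: _).
by apply: eq_bigr => j jS; case: eqP => // ji; move: iS; rewrite -ji jS.
Qed.

(** Rado's argument.  If neither deletion were harmless, two sets [S1] and [S2]
    of indices would be tight after the deletions; counting the union and the
    intersection of what they cover contradicts the condition for
    [i |: (S1 :|: S2)] and [S1 :&: S2]. *)
Lemma hall_shrink A i x y : hall_condition A ->
  x != y -> x \in A i -> y \in A i ->
  hall_condition (shrink A i x) \/ hall_condition (shrink A i y).
Proof.
move=> hA xy xA yA.
have fails z : ~ hall_condition (shrink A i z) ->
    exists2 S : {set D}, i \notin S & #|(A i :\ z) :|: \bigcup_(j in S) A j| <= #|S|.
  move=> /existsNP[S /negP]; rewrite -ltnNge.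
  case: (boolP (i \in S)) => [iS|iS].
    have iS' : i \notin S :\ i by rewrite !inE eqxx.
    rewrite -{1}(finset.setD1K iS) shrink_cover // [#|S|](cardsD1 i) iS add1n ltnS.
    by exists (S :\ i).
  rewrite ltnNge => /negP[]; apply: leq_trans (hA S) _.
  apply: subset_leq_card; apply/bigcupsP => j jS; apply: (bigcup_max j) => //.
  by rewrite /shrink; case: eqP => // ji; move: iS; rewrite -ji jS.
case: (pselect (hall_condition (shrink A i x))); first by left.
case: (pselect (hall_condition (shrink A i y))); first by right.
move=> /fails[S2 iS2 le2] /fails[S1 iS1 le1].
set C1 := _ :|: _ in le1; set C2 := _ :|: _ in le2.
have : #|i |: (S1 :|: S2)| <= #|C1 :|: C2|.
  apply: leq_trans (hA _) (subset_leq_card _).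
  rewrite finset.bigcup_setU big_set1 finset.bigcup_setU; apply/fintype.subsetP => z.
  rewrite !inE; case: (eqVneq z x) => [->|zx /=]; first by rewrite xy xA !orbT.
  by case/or3P => ->; rewrite ?orbT.
have : #|S1 :&: S2| <= #|C1 :&: C2|.
  apply: leq_trans (hA _) (subset_leq_card _).
  apply/bigcupsP => j; rewrite inE => /andP[j1 j2]; apply/fintype.subsetP => z zA.
  by rewrite !inE; apply/andP; split; apply/orP; right; apply/bigcupP; exists j.
rewrite cardsU1 !inE negb_or iS1 iS2 /= add1n.
have := cardsUI S1 S2; have := cardsUI C1 C2; lia.
Qed.

Lemma hall_theorem A : hall_condition A ->
  exists2 g : D -> T, injective g & forall i, g i \in A i.
Proof.
have [n] := ubnP (\sum_i #|A i|); elim: n A => // n IH A; rewrite ltnS => le_n hA.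
have ne i : 0 < #|A i|.
  by have := hA [set i]; rewrite cards1 big_set1.
case: (boolP [exists i, 1 < #|A i|]) => [/existsP[i /card_gt1P[x [y [xA yA xy]]]]|].
  have step z : z \in A i -> hall_condition (shrink A i z) ->
      exists2 g : D -> T, injective g & forall i, g i \in A i.
    move=> zA /IH[|g ginj gA].
      apply: leq_trans le_n; rewrite [in leqRHS](bigD1 i) //= (bigD1 i) //=.
      rewrite /shrink eqxx [#|A i|](cardsD1 z) zA add1n ltnS leq_add2l.
      by apply: leq_sum => j /negbTE ->.
    exists g => // j; have := gA j; rewrite /shrink; case: eqP => // ->.
    by case/setD1P.
  by case: (hall_shrink hA xy xA yA); apply: step.
rewrite negb_exists => /forallP le1.
have sing i : {x | A i = [set x]}.
  by apply/cid/cards1P; rewrite eqn_leq ne andbT leqNgt.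
exists (fun i => projT1 (sing i)) => [i j|i]; last first.
  by case: (sing i) => x /= ->; rewrite inE.
case: (sing i) (sing j) => x /= Ax [y /= Ay] xy; apply/eqP; apply: contraT => ij.
have := hA [set i; j].
by rewrite cards2 ij finset.bigcup_setU !big_set1 Ax Ay xy finset.setUid cards1.
Qed.

End Hall.

Section Pigeonhole.
Local Open Scope nat_scope.

Lemma large_fiber (T : finType) (k : nat -> T) (s : seq nat) t :
  0 < t -> #|T| * t <= size s -> s != [::] ->
  exists y, t <= size [seq x <- s | k x == y].
Proof.
move=> t0 le_s s0; apply/existsP; apply: contraT; rewrite negb_exists => /forallP H.
have : size s <= #|T| * t.-1.
  rewrite -sum1_size (partition_big k predT) //= -sum_nat_const.
  apply: leq_sum => y _; rewrite sum1_count -size_filter.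
  by have := H y; rewrite -ltnNge; lia.
have : 0 < #|T| by case: (s) s0 => // x ? _; apply/card_gt0P; exists (k x).
nia.
Qed.

Definition subset_of_size (T : eqType) t (X : seq T) (P : {pred T}) :=
  [/\ uniq X, size X = t & {subset X <= P}].

Definition complete_between (c : rel nat) col (X Y : seq nat) :=
  {in X & Y, forall x y, c x y = col}.

(** Many vertices of [Q] see the same color pattern on [2 * t] fixed vertices of
    [P], and half of that pattern is constant. *)
Lemma bipartite_ramsey (c : rel nat) t (P Q : seq nat) :
  0 < t -> uniq P -> uniq Q -> 2 * t <= size P -> 2 ^ (2 * t) * t <= size Q ->
  exists col X Y,
    [/\ subset_of_size t X (mem P), subset_of_size t Y (mem Q) & complete_between c col X Y].
Proof.
move=> t0 uP uQ sP sQ.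
pose P' := take (2 * t) P.
have sP' : size P' = 2 * t by rewrite size_take_min; apply/minn_idPl.
pose k v := [ffun i : 'I_(2 * t) => c (nth 0 P' i) v].
have [||y sy] := @large_fiber _ k Q t t0.
- by rewrite card_ffun card_bool card_ord.
- by rewrite -size_eq0 -lt0n; apply: leq_trans sQ; rewrite muln_gt0 expn_gt0 t0.
set Y1 := [seq _ <- _ | _] in sy.
have eqP' v p : v \in Y1 -> p \in P' -> forall v', v' \in Y1 -> c p v = c p v'.
  rewrite mem_filter => /andP[/eqP kv _] pP v'; rewrite mem_filter => /andP[/eqP kv' _].
  have ip : index p P' < 2 * t by rewrite -sP' index_mem.
  have /ffunP/(_ (Ordinal ip)) : k v = k v' by rewrite kv kv'.
  by rewrite !ffunE /= nth_index.
have [v0 v0Y] : exists v, v \in Y1.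
  by case: Y1 sy {eqP'} => [|v Y1 _]; [rewrite leqNgt t0 | exists v; rewrite mem_head].
have uP' : uniq P' by apply: take_uniq.
have [||col sX] := @large_fiber _ (fun p => c p v0) P' t t0.
- by rewrite card_bool sP'.
- by rewrite -size_eq0 sP' -lt0n muln_gt0 t0.
set X1 := [seq _ <- _ | _] in sX.
exists col, (take t X1), (take t Y1); split.
- split; first by rewrite take_uniq // filter_uniq.
    by rewrite size_take_min; apply/minn_idPl.
  by move=> x /mem_take; rewrite mem_filter => /andP[_ /mem_take].
- split; first by rewrite take_uniq // filter_uniq.
    by rewrite size_take_min; apply/minn_idPl.
  by move=> x /mem_take; rewrite mem_filter => /andP[].
move=> x v /mem_take; rewrite mem_filter => /andP[/eqP <- xP] /mem_take vY.
exact: eqP'.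
Qed.

End Pigeonhole.

(** * Optimal packings *)

Lemma big_mem_ord (t : seq nat) N (F : nat -> nat) : uniq t ->
  {in t, forall v, (v < N)%N} ->
  (\sum_(v <- t) F v = \sum_(v < N | nat_of_ord v \in t) F v)%N.
Proof.
move=> ut tN.
have pt : perm_eq t [seq v <- iota 0 N | v \in t].
  apply: uniq_perm => //; first by rewrite filter_uniq ?iota_uniq.
  move=> v; rewrite mem_filter mem_iota add0n leq0n /=.
  by case: (boolP (v \in t)) => // /tN ->.
rewrite (perm_big _ pt) big_filter /= -[in iota _ N](subn0 N) -/(index_iota 0 N).
by rewrite big_mkord.
Qed.

Section Potential.
Local Open Scope nat_scope.
Context (tile : pred (seq nat)) (s w : nat -> nat) (A cap maxsize : nat).
Implicit Types (t : seq nat) (P : seq (seq nat)).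

Definition load P v := count (fun t => v \in t) P.

Definition packing P := all tile P /\ forall v, load P v <= cap.

Hypothesis tile_uniq : forall t, tile t -> uniq t.
Hypothesis packing_size : forall P, packing P -> size P <= maxsize.

Definition cost x := \sum_(i < x) w i.
Definition vertex_bound P := (\max_(v <- flatten P) v).+1.

Lemma vertex_bound_gt P t v : t \in P -> v \in t -> v < vertex_bound P.
Proof.
move=> tP vt; rewrite ltnS (@leq_bigmax_seq _ _ xpredT id v) //.
by apply/flattenP; exists t.
Qed.

(** The vertices are all natural numbers; truncating the sum at [N] is harmless
    as soon as [N] exceeds every vertex in use, see [penalty_widen]. *)
Definition penalty P N := \sum_(v < N) s v * cost (load P v).

Lemma penalty_widen P N : vertex_bound P <= N -> penalty P N = penalty P (vertex_bound P).
Proof.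
move=> le_N; rewrite /penalty.
rewrite -(big_mkord xpredT (fun v => s v * cost (load P v))) /=.
rewrite (big_cat_nat (leq0n _) le_N) //= big_mkord big_nat_cond.
rewrite [X in _ + X]big1 ?addn0 // => v /andP[/andP[sv _] _].
suff -> : load P v = 0 by rewrite /cost big_ord0 muln0.
apply/eqP; rewrite -leqn0 leqNgt -has_count; apply/hasPn => t tP.
by apply/negP => vt; move: sv; rewrite leqNgt (vertex_bound_gt tP vt).
Qed.

Lemma penalty_cons t P N : uniq t -> {in t, forall v, v < N} ->
  penalty (t :: P) N = penalty P N + \sum_(v <- t) s v * w (load P v).
Proof.
move=> ut tN; rewrite /penalty.
rewrite (big_mem_ord _ ut tN) [X in _ = _ + X]big_mkcond -big_split /=.
apply: eq_bigr => v _; rewrite /load /=; case: ifP => _; last by rewrite addn0.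
by rewrite add1n /cost big_ord_recr mulnDr.
Qed.

Local Notation value P N := ((A * size P)%:Z - (penalty P N)%:Z)%R.

(** Take a packing that maximizes [A] times the number of tiles minus the penalty
    on loads: adding or removing one tile does not improve it.  This is
    complementary slackness with the marginal penalties [w] as dual weights.  No
    tile that could still be added is lighter than [A], and no tile in use is
    heavier than [A] when weights are taken just before its insertion. *)
Lemma optimal_packing : exists2 P, packing P &
  (forall t, tile t -> {in t, forall v, load P v < cap} ->
     A <= \sum_(v <- t) s v * w (load P v)) /\
  (forall t, t \in P -> \sum_(v <- t) s v * w (load P v).-1 <= A).
Proof.
pose reach k := exists2 P, packing P & value P (vertex_bound P) = k%:Z%R.
have r0 : reach 0.
  exists [::]; first by split.
  by rewrite muln0 /penalty big1 // => v _; rewrite /cost big_ord0 muln0.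
have exr : exists k, `[< reach k >] by exists 0; apply/asboolP.
have bdr k : `[< reach k >] -> k <= A * maxsize.
  move=> /asboolP[P /packing_size le eq].
  have := leq_mul (leqnn A) le; lia.
have [k /asboolP[P pP Pk] maxk] := ex_maxnP exr bdr.
have best P' N : packing P' -> vertex_bound P <= N -> vertex_bound P' <= N -> (value P' N <= value P N)%R.
  move=> pP' le le'; rewrite !penalty_widen // Pk.
  case: (leP 0%R (value P' (vertex_bound P'))) => [|lt0]; last first.
    by apply: le_trans (ltW lt0) _.
  case E : (value P' (vertex_bound P')) => [j|j] // _.
  by have := maxk j; rewrite lez_nat; apply; apply/asboolP; exists P'.
exists P => //; split.
  move=> t tt tcap.
  have pt : packing (t :: P).
    case: pP => aP cP; split; first by rewrite /= tt.
    move=> v; rewrite /load /=; case: (boolP (v \in t)) => [/tcap|_] //.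
    by rewrite add0n; exact: cP.
  pose N := maxn (vertex_bound P) (vertex_bound (t :: P)).
  have := best _ N pt (leq_maxl _ _) (leq_maxr _ _).
  rewrite penalty_cons ?tile_uniq //=; first by rewrite mulnS; lia.
  move=> v vt; apply: leq_trans (leq_maxr _ _).
  by apply: vertex_bound_gt vt; rewrite mem_head.
move=> t tP.
have pe := perm_to_rem tP; set P' := rem t P in pe.
have ld v : load P v = (v \in t) + load P' v by rewrite /load (permP pe).
have tt : tile t by case: pP => /allP/(_ _ tP).
have pP' : packing P'.
  case: pP => aP cP; split; last by move=> v; apply: leq_trans (cP v); rewrite ld leq_addl.
  by move: aP; rewrite (perm_all _ pe) /= => /andP[].
pose N := maxn (vertex_bound P) (vertex_bound P').
have tN : {in t, forall v, v < N}.
  move=> v vt; apply: leq_trans (leq_maxl _ _).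
  exact: vertex_bound_gt tP vt.
have := best _ N pP' (leq_maxl _ _) (leq_maxr _ _).
have -> : penalty P N = penalty (t :: P') N.
  by apply: eq_bigr => v _; rewrite ld.
rewrite penalty_cons ?tile_uniq // (perm_size pe) /= mulnS.
have -> : \sum_(v <- t) s v * w (load P v).-1 = \sum_(v <- t) s v * w (load P' v).
  by rewrite big_seq [RHS]big_seq; apply: eq_bigr => v vt; rewrite ld vt.
lia.
Qed.

Lemma sum_load P (F : nat -> nat) N : all tile P -> vertex_bound P <= N ->
  \sum_(t <- P) \sum_(v <- t) F v = \sum_(v < N) load P v * F v.
Proof.
elim: P N => [|t P IH] N /=.
  by move=> _ _; rewrite big_nil big1.
case/andP=> tt aP sN; rewrite big_cons.
have sP : vertex_bound P <= N.
  by apply: leq_trans sN; rewrite /vertex_bound /= big_cat ltnS leq_maxr.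
have tN : {in t, forall v, v < N}.
  move=> v vt; apply: leq_trans sN.
  by apply: vertex_bound_gt vt; rewrite mem_head.
rewrite (IH N) // (big_mem_ord _ (tile_uniq tt) tN) [X in X + _ = _]big_mkcond -big_split /=.
by apply: eq_bigr => v _; rewrite /load /= mulnDl; case: ifP => _; rewrite ?mul1n ?mul0n.
Qed.

End Potential.

(** * Packings by complete bipartite graphs, or cuts *)

Section Thinning.
Local Open Scope nat_scope.

(** Incidences between [S] and what it covers are at least [d * #|S|] and at most
    [d] times the size of the cover. *)
Lemma hall_regular (D T : finType) (A : D -> {set T}) d : 0 < d ->
  (forall i, d <= #|A i|) -> (forall v, #|[set i | v \in A i]| <= d) ->
  hall_condition A.
Proof.
move=> d0 dA dv S; rewrite -(leq_pmul2r d0).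
apply: (@leq_trans (\sum_(i in S) #|A i|)).
  by rewrite -sum_nat_const; apply: leq_sum.
under eq_bigr do rewrite -sum1_card.
rewrite (exchange_big_dep (mem (\bigcup_(i in S) A i))) /=; last first.
  by move=> i v iS vA; apply/bigcupP; exists i.
rewrite -sum_nat_const; apply: leq_sum => v _.
apply: leq_trans (dv v); rewrite sum1_card; apply: subset_leq_card.
by apply/fintype.subsetP => i; rewrite !inE => /andP[].
Qed.

(** Passage from a fractional to an integral packing: sets that are [K] times too
    large and overlap at most [K] times shrink to disjoint sets of the right
    size, by Hall's theorem. *)
Lemma thinning K b M (Xs : seq (seq nat)) : size Xs = M -> 0 < K -> 0 < b ->
  (forall X, X \in Xs -> uniq X /\ size X = K * b) ->
  (forall v, load Xs v <= K) ->
  exists g : 'I_M -> seq nat,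
    (forall i, subset_of_size b (g i) (mem (nth [::] Xs i))) /\
    uniq (flatten [seq g i | i <- enum 'I_M]).
Proof.
move=> sM K0 b0 hX hv; pose N := vertex_bound Xs.
pose X (i : 'I_M) := nth [::] Xs i.
have XXs i : X i \in Xs by apply: mem_nth; rewrite sM.
pose A (p : 'I_M * 'I_b) : {set 'I_N} := [set v | nat_of_ord v \in X p.1].
have hA : hall_condition A.
  apply: (@hall_regular _ _ _ (K * b)); first by rewrite muln_gt0 K0.
    move=> [i j]; rewrite /A /=; have [uX <-] := hX _ (XXs i).
    have -> : size (X i) = size (pmap (insub : nat -> option 'I_N) (X i)).
      rewrite size_pmap; apply/esym/eqP; rewrite -all_count; apply/allP => v vX.
      by rewrite /= insubT //; exact: vertex_bound_gt (XXs i) vX.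
    rewrite -(card_uniqP _); last exact: pmap_sub_uniq.
    apply: subset_leq_card; apply/fintype.subsetP => v.
    by rewrite mem_pmap_sub inE.
  move=> v; have -> : [set p | v \in A p] = finset.setX [set i | nat_of_ord v \in X i] [set: 'I_b].
    by apply/setP => -[i j]; rewrite !inE andbT.
  rewrite cardsX cardsT card_ord leq_pmul2r //; apply: leq_trans (hv v).
  rewrite /load -sum1_count (big_nth [::]) sM big_mkord sum1_card.
  by apply: subset_leq_card; apply/fintype.subsetP => i; rewrite !inE.
have [f finj fA] := hall_theorem hA.
exists (fun i => [seq val (f (i, j)) | j <- enum 'I_b]); split.
  move=> i; split.
  - by rewrite map_inj_uniq ?enum_uniq // => j j' /val_inj/finj[].
  - by rewrite size_map size_enum_ord.
  - by move=> _ /mapP[j _ ->]; have := fA (i, j); rewrite inE.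
apply: allpairs_uniq; rewrite ?enum_uniq // => -[i j] [i' j'] _ _ /= /val_inj/finj[-> ->] //.
Qed.

Lemma perm_flatten_pairs (T : eqType) (s : seq (seq T * seq T)) :
  perm_eq (flatten [seq p.1 ++ p.2 | p <- s])
          (flatten (unzip1 s) ++ flatten (unzip2 s)).
Proof.
elim: s => //= -[x y] s IH /=; rewrite -!catA perm_cat2l.
rewrite perm_sym perm_catCA perm_cat2l perm_sym; exact: IH.
Qed.

End Thinning.

Lemma sum_const_seq (T : Type) (r : seq T) n : (\sum_(i <- r) n = size r * n)%N.
Proof. by rewrite big_const_seq count_predT iter_addn_0 mulnC. Qed.

Lemma sum_levels J x : (\sum_(i < J) (i < x) <= x)%N.
Proof.
rewrite -(big_mkord xpredT (fun i => nat_of_bool (i < x)%N)) /=.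
elim: J => [|J IH]; first by rewrite big_nil.
case: (leqP x J) => [xJ|Jx].
  by rewrite big_nat_recr //= ltnNge xJ addn0.
apply: leq_trans Jx; apply: (@leq_trans (\sum_(0 <= i < J.+1) 1)%N).
  by apply: leq_sum => i _; case: (i < x)%N.
by rewrite sum_nat_const_nat subn0 muln1.
Qed.

Section TilingAlternative.
Local Open Scope nat_scope.
Context (c : rel nat) (col : bool) (k : nat -> nat) (Z : pred nat) (Y0 : seq nat).

(** A complete bipartite graph of color [col] that can become part of a copy of
    [F]: the side [X] receives the neighborhood of [I], hence lies in a single
    class (a fiber of [k]), and [Y] receives [I]. *)
Definition block r s (X Y : seq nat) :=
  [/\ subset_of_size r X Z, {in X &, forall x y, k x = k y},
      subset_of_size s Y (mem Y0) & complete_between c col X Y].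

(** Linear programming duality for packings of [Y0] by blocks, in a form where
    the primal solution is integral.  Take an optimal packing by blocks enlarged
    [J ^ 2] times, each vertex being used at most [J ^ 2] times, with marginal
    penalties that are positive only for the last [J] uses.  [thinning] turns it
    into as many disjoint blocks of the original size.  At a level [i], let [U]
    be the set of vertices of [Z] of weight above [i] and [Q] that of vertices of
    [Y0] of weight below [J - i].  An enlarged block avoiding [U] with its second
    side in [Q] would be too light, so none exists; and averaging over the [J]
    levels bounds [U] and the complement of [Q] by the total weight, which is
    comparable to the size of the packing. *)
Lemma tiling_alternative a b J : 0 < a -> 0 < b -> 1 < J ->
  uniq Y0 -> {in Y0, forall v, ~~ Z v} ->
  exists Bl : seq (seq nat * seq nat), exists U Q : seq nat,
  [/\ {in Bl, forall p, block b a p.1 p.2},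
      uniq (flatten [seq p.1 ++ p.2 | p <- Bl]),
      [/\ uniq U, uniq Q & {subset Q <= Y0}],
      J.-1 * (a * size U + b * (size Y0 - size Q)) <= a * b * size Bl * (J + 2) &
      forall X Y, block (J ^ 2 * b) (J ^ 2 * a) X Y ->
        {in X, forall v, v \notin U} -> {subset Y <= Q} -> False].
Proof.
move=> a0 b0 J1 uY YZ; pose K := J ^ 2.
have KJ : J < K by rewrite /K expnS expn1 -[X in X < _]muln1 ltn_pmul2l // ltnW.
pose tile := [pred t : seq nat | `[< exists X Y, t = X ++ Y /\ block (K * b) (K * a) X Y >]].
pose s v := if Z v then a else b.
pose w x := x - (K - J).
have tile_uniq t : tile t -> uniq t.
  move=> /asboolP[X [Y [-> [[uX _ XZ] _ [uY' _ YY0] _]]]].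
  rewrite cat_uniq uX uY' andbT; apply/hasPn => y /YY0 /YZ yZ.
  by apply/negP => /XZ; rewrite unfold_in (negbTE yZ).
have sumF t (F : nat -> nat) : tile t -> exists X Y, block (K * b) (K * a) X Y /\
    t = X ++ Y /\ \sum_(v <- t) s v * F v = a * \sum_(v <- X) F v + b * \sum_(v <- Y) F v.
  move=> /asboolP[X [Y [-> bl]]]; exists X, Y; split=> //; split => //.
  case: bl => -[_ _ XZ] _ [_ _ YY0] _.
  rewrite big_cat !big_distrr /=; congr (_ + _); rewrite big_seq [RHS]big_seq.
    by apply: eq_bigr => v /XZ; rewrite unfold_in /s => ->.
  by apply: eq_bigr => v /YY0/YZ /negbTE; rewrite /s => ->.
have YN N v : vertex_bound [:: Y0] <= N -> v \in Y0 -> v < N.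
  by move=> le vY; apply: leq_trans le; apply: (vertex_bound_gt (mem_head _ _)).
have a_Y0 t : tile t -> K * a <= \sum_(v <- t) (v \in Y0).
  move=> /asboolP[X [Y [-> [_ _ [_ <- YY0] _]]]].
  rewrite big_cat /= -[leqLHS]add0n leq_add // big_seq -sum1_size [leqLHS]big_seq.
  by apply: leq_sum => v /YY0 ->.
have psize P : packing tile K P -> a * size P <= size Y0.
  move=> [aP ldK]; pose N := maxn (vertex_bound P) (vertex_bound [:: Y0]).
  have := sum_load tile_uniq (fun v => nat_of_bool (v \in Y0)) aP (leq_maxl _ _ : _ <= N).
  move=> E; have : size P * (K * a) <= K * size Y0.
    apply: (@leq_trans (\sum_(t <- P) \sum_(v <- t) (v \in Y0))).
      rewrite -sum_const_seq big_seq [leqRHS]big_seq.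
      by apply: leq_sum => t /(allP aP)/a_Y0.
    rewrite E -(sum1_size Y0) (big_mem_ord _ uY (YN N ^~ (leq_maxr _ _))).
    rewrite big_distrr /= [leqRHS]big_mkcond; apply: leq_sum => v _.
    by case: ifP => _; rewrite ?muln0 // !muln1.
  by rewrite mulnC -mulnA leq_pmul2l ?(ltn_trans _ KJ) // ltnW.
have [|P [aP ldK] [optA optR]] := @optimal_packing tile s w (K * a * b * J) K (size Y0) tile_uniq.
  by move=> P /psize; apply: leq_trans; apply: leq_pmull.
pose N := maxn (vertex_bound P) (vertex_bound [:: Y0]).
(* The level [i] of the program is counted from 0, hence the shift in [Q]. *)
pose U (i : nat) := [seq v <- iota 0 N | Z v && (i < w (load P v))].
pose Q (i : nat) := [seq v <- Y0 | w (load P v) <= J - i.+1].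
pose G i := a * size (U i) + b * (size Y0 - size (Q i)).
have GE i : G i = \sum_(v < N) (a * (Z v && (i < w (load P v)))
                   + b * ((nat_of_ord v \in Y0) && (J - i.+1 < w (load P v)))).
  rewrite /G; have -> : size (U i) = \sum_(v < N) (Z v && (i < w (load P v))).
    rewrite -sum1_size big_filter -[in iota _ N](subn0 N) -/(index_iota 0 N).
    by rewrite big_mkord big_mkcond; apply: eq_bigr => v _; case: ifP.
  have -> : size Y0 - size (Q i) = \sum_(v < N) ((nat_of_ord v \in Y0) && (J - i.+1 < w (load P v))).
    rewrite size_filter -(count_predC (fun v => w (load P v) <= J - i.+1) Y0) addKn.
    rewrite -sum1_count big_mkcond (big_mem_ord _ uY (YN N ^~ (leq_maxr _ _))).
    rewrite big_mkcond; apply: eq_bigr => v _ /=; rewrite -ltnNge.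
    by case: (_ \in _); case: (_ < _).
  by rewrite 2!big_distrr -big_split.
have sumG : \sum_(i < J) G i <= \sum_(v < N) s v * w (load P v).
  under eq_bigr do rewrite GE.
  rewrite exchange_big /=; apply: leq_sum => v _.
  rewrite big_split /= -!big_distrr /= /s.
  case: (boolP (Z v)) => [Zv|nZv] /=.
    have -> : (nat_of_ord v \in Y0) = false by apply/negP => /YZ; rewrite Zv.
    by rewrite [X in b * X]big1 // muln0 addn0 leq_mul2l sum_levels orbT.
  rewrite [X in a * X]big1 // muln0 add0n leq_mul2l; apply/orP; right.
  apply: leq_trans (sum_levels J _); rewrite [leqRHS](reindex_inj rev_ord_inj) /=.
  by apply: leq_sum => i _; case: (_ \in _).
(* Only loads above [K - J] carry weight, so total weight is at most a factor
   [1 / (K - J)] of weight counted with load, up to the last increment. *)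
have wbound x : (K - J) * w x <= x * w x.-1 + x.
  rewrite /w; case: x => [|x] /=; first by rewrite muln0.
  case: (leqP x.+1 (K - J)) => [le|]; first by rewrite (eqP le) muln0.
  rewrite ltnS => le; rewrite subSn // mulnS addnC leq_add //; first by rewrite leq_mul2r ltnW ?orbT.
  exact: ltnW.
have upper : (K - J) * \sum_(v < N) s v * w (load P v) <= size P * (K * a * b * (J + 2)).
  apply: (@leq_trans (\sum_(v < N) load P v * (s v * w (load P v).-1)
                     + \sum_(v < N) load P v * (s v * 1))).
    rewrite -big_split big_distrr /=; apply: leq_sum => v _.
    by have := wbound (load P v); set x := load P v; move: (w x) (w x.-1); nia.
  rewrite -(sum_load tile_uniq (fun v => s v * w (load P v).-1) aP (leq_maxl _ _)).
  rewrite -(sum_load tile_uniq (fun v => s v * 1) aP (leq_maxl _ _)) 2!mulnDr.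
  rewrite -!sum_const_seq; apply: leq_add.
    by rewrite big_seq [leqRHS]big_seq; apply: leq_sum => t /optR.
  rewrite big_seq [leqRHS]big_seq; apply: leq_sum => t /(allP aP) tt.
  have [X [Y [[[_ sX _] _ [_ sY _] _] [_ ->]]]] := sumF t (fun=> 1) tt.
  by rewrite !sum1_size sX sY; nia.
have [i iJ Gi] : exists2 i, i < J & J.-1 * G i <= a * b * size P * (J + 2).
  apply/not_exists2P => H.
  have big i : i < J -> a * b * size P * (J + 2) < J.-1 * G i.
    by move=> iJ; rewrite ltnNge; apply/negP => le; case: (H i).
  have : J * (a * b * size P * (J + 2)).+1 <= J.-1 * \sum_(i < J) G i.
    rewrite -{1}(card_ord J) -sum_nat_const big_distrr /=.
    by apply: leq_sum => i _; apply: big.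
  have := leq_mul (leqnn (K - J)) sumG.
  have -> : K - J = J * J.-1 by rewrite /K expnS expn1; nia.
  move: upper; have -> : K - J = J * J.-1 by rewrite /K expnS expn1; nia.
  rewrite /K expnS expn1.
  move: (\sum_(i < J) G i) (\sum_(v < N) _) => g1 g2.
  move: (size P) => p u1 u2 u3.
  have : J * (J.-1 * g1) <= J * (J * (a * b * p * (J + 2))).
    apply: (@leq_trans (J * J.-1 * g2)); first by rewrite mulnA.
    by apply: leq_trans u1 _; apply: eq_leq; ring.
  rewrite leq_pmul2l ?(ltnW J1) // => u4.
  by have := leq_trans u3 u4; rewrite leq_pmul2l ?ltnn // ltnW.
have tileE t : tile t -> block (K * b) (K * a) [seq v <- t | Z v] [seq v <- t | ~~ Z v].
  move=> /asboolP[X [Y [-> bl]]]; rewrite !filter_cat.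
  have [[_ _ XZ] _ [_ _ YY0] _] := bl.
  have /all_filterP -> : all Z X by apply/allP => x /XZ.
  have /all_filterP -> : all (fun v => ~~ Z v) Y by apply/allP => y /YY0 /YZ.
  rewrite (eq_in_filter (a2 := pred0)) ?filter_pred0 => [|y /YY0/YZ/negbTE] //.
  rewrite (eq_in_filter (a2 := pred0)) ?filter_pred0 => [|x /XZ] //; first by rewrite cats0.
  by rewrite unfold_in => ->.
have ld (z : pred nat) v : load [seq [seq u <- t | z u] | t <- P] v <= K.
  apply: leq_trans (ldK v); rewrite /load count_map; apply: sub_count => t /=.
  by rewrite mem_filter => /andP[].
have K0 : 0 < K by apply: leq_trans KJ.
have [|g [gX gU]] := thinning (size_map _ P) K0 b0 _ (ld Z).
  by move=> _ /mapP[t /(allP aP)/tileE[[? ? _] _ _ _] ->].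
have [|g' [gX' gU']] := thinning (size_map _ P) K0 a0 _ (ld (predC Z)).
  by move=> _ /mapP[t /(allP aP)/tileE[_ _ [? ? _] _] ->].
have tn (i' : 'I_(size P)) : tile (nth [::] P i') by apply: (allP aP); apply: mem_nth.
exists [seq (g i, g' i) | i <- enum 'I_(size P)], (U i), (Q i); split.
- move=> _ /mapP[i' _ ->] /=.
  have [ug sg] := gX i'; rewrite (nth_map [::]) //= => subg.
  have [ug' sg'] := gX' i'; rewrite (nth_map [::]) //= => subg'.
  have [[_ _ XZ] kX [_ _ YY] XY] := tileE _ (tn i').
  split.
  + by split=> // x /subg/XZ.
  + by move=> x y /subg xX /subg; apply: kX.
  + by split=> // x /subg'/YY.
  + by move=> x y /subg xX /subg'; apply: XY.
- rewrite (perm_uniq (perm_flatten_pairs _)).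
  rewrite [unzip1 _](_ : _ = [seq g i | i <- enum 'I_(size P)]); last by rewrite /unzip1 -map_comp.
  rewrite [unzip2 _](_ : _ = [seq g' i | i <- enum 'I_(size P)]); last by rewrite /unzip2 -map_comp.
  rewrite cat_uniq gU gU' andbT /=; apply/hasPn => y /flattenP[_ /mapP[i1 _ ->]].
  have [_ _] := gX' i1; rewrite (nth_map [::]) // => sub /sub.
  rewrite mem_filter => /andP[nZ _]; apply/negP => /flattenP[_ /mapP[i2 _ ->]].
  have [_ _] := gX i2; rewrite (nth_map [::]) // => sub2 /sub2.
  by rewrite mem_filter (negbTE nZ).
- by split; [rewrite filter_uniq ?iota_uniq | rewrite filter_uniq | move=> v; rewrite mem_filter => /andP[]].
- by rewrite size_map size_enum_ord.
move=> X Y bl XU YQ.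
have [[uX sX XZ] _ [uY' sY YY0] _] := bl.
have tXY : tile (X ++ Y) by apply/asboolP; exists X, Y.
have wX v : v \in X -> w (load P v) <= i.
  move=> vX; have := XU _ vX; rewrite mem_filter mem_iota add0n leq0n /= !negb_and -leqNgt.
  have -> : Z v by apply: XZ.
  case/orP => //; rewrite -leqNgt => Nv.
  suff -> : load P v = 0 by rewrite /w sub0n.
  apply/eqP; rewrite -leqn0 leqNgt -has_count; apply/hasPn => t tP.
  apply/negP => vt; move: Nv; rewrite leqNgt => /negP[].
  exact: leq_trans (vertex_bound_gt tP vt) (leq_maxl _ _).
have wY v : v \in Y -> w (load P v) <= J - i.+1.
  by move=> /YQ; rewrite mem_filter => /andP[].
(* A load equal to [K] has weight [J], which both sides exclude: the block can be
   added to the packing. *)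
have := optA _ tXY; rewrite leqNgt => /(_ _)/negP[].
  move=> v; rewrite mem_cat => /orP[/wX|/wY]; rewrite /w; lia.
apply: (@leq_ltn_trans (K * b * (a * i) + K * a * (b * (J - i.+1)))).
  rewrite big_cat /= -sX -sY -!sum_const_seq; apply: leq_add; rewrite [leqLHS]big_seq [leqRHS]big_seq.
    apply: leq_sum => v vX; rewrite /s; have -> : Z v by apply: XZ.
    by rewrite leq_mul2l wX // orbT.
  apply: leq_sum => v vY; rewrite /s (negbTE (YZ _ (YY0 _ vY))).
  by rewrite leq_mul2l wY // orbT.
have -> : K * b * (a * i) + K * a * (b * (J - i.+1)) = K * a * b * (i + (J - i.+1)) by ring.
rewrite ltn_pmul2l ?muln_gt0 ?K0 ?a0 ?b0 //; lia.
Qed.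

End TilingAlternative.

(** * Classes of vertices *)

Section VertexClasses.
Local Open Scope nat_scope.
Local Open Scope classical_set_scope.
Context (c : rel nat) (c_sym : symmetric c).
Implicit Types (U : set_system nat) (C D : set nat) (col : bool).

(** Finite cliques placed beyond any bound [N], rather than one infinite clique:
    this is all that copies of a finite graph need, and it is what makes the
    decomposition into classes terminate. *)
Definition clique_attached col m C := forall (S : seq nat) (N : nat),
  {in S, forall v, C v} ->
  exists K : seq nat, [/\ uniq K, size K = m, {in K, forall x, N <= x},
    complete_between c col S K & {in K &, forall x y, x != y -> c x y = col}].

Definition free U := UltraFilter U /\ forall N, U [set x | N <= x].

Lemma free_on D : (forall N, exists2 x, N <= x & D x) ->
  exists U, free U /\ U D.
Proof.
move=> infD.
pose F := filter_from setT (fun N => D `&` [set x | N <= x]).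
have FF : Filter F.
  apply: filter_from_filter => [|i j _ _]; first by exists 0.
  exists (maxn i j) => // x [Dx /=]; rewrite geq_max => /andP[ix jx].
  by split; split.
have PF : ProperFilter F.
  apply: filter_from_proper => N _; have [x Nx Dx] := infD N; by exists x.
have [U [UU sFU]] := ultraFilterLemma PF.
exists U; split; first split => // N.
  by apply: sFU; exists N => // x [].
by apply: sFU; exists 0 => // x [].
Qed.

(** The color of the edges from [v] to almost all vertices, in the sense of the
    ultrafilter [U]. *)
Definition toward U v := `[< U [set x | c v x = true] >].

Lemma towardP U v : UltraFilter U -> U [set x | c v x = toward U v].
Proof.
move=> UU; rewrite /toward; case: asboolP => // nU.
have [//|] := in_ultra_setVsetC [set x | c v x = true] UU.
by apply: filterS => x /= /negP/negbTE.
Qed.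

Definition linked col U U' := U [set x | toward U' x = col].

Definition seen col (L : seq (set_system nat)) : set nat :=
  [set v | forall U, U \in L -> toward U v = col].

(** The head of the list is linked to all ultrafilters that follow it, so that
    vertices picked along the list one by one can form a clique. *)
Fixpoint chain col (L : seq (set_system nat)) : Prop :=
  if L is U :: L' then
    [/\ free U, (forall U', U' \in L' -> linked col U U') & chain col L']
  else True.

Lemma filter_all (T : eqType) U (L : seq T) (P : T -> set nat) : Filter U ->
  (forall v, v \in L -> U (P v)) -> U [set x | forall v, v \in L -> P v x].
Proof.
move=> FU; elim: L => [|v L IH] H.
  by apply: (@filterS _ U _ setT); [move=> x _ u; rewrite in_nil | exact: filterT].
have HL : forall u, u \in L -> U (P u) by move=> u uL; apply: H; rewrite inE uL orbT.
have := @filterI _ U FU _ _ (H v (mem_head _ _)) (IH HL).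
by apply: filterS => x [Px Lx] u; rewrite inE => /predU1P[->|/Lx].
Qed.

Lemma clique_attached_sub col m C C' : C' `<=` C ->
  clique_attached col m C -> clique_attached col m C'.
Proof. by move=> CC' gC S N SC; apply: gC => v /SC /CC'. Qed.

(** A clique is picked along the chain: almost every vertex for the head [U] is
    joined in color [col] to the given finite set and is itself seen in color
    [col] by the rest of the chain, hence may be added to the finite set. *)
Lemma chain_attached col L : chain col L -> clique_attached col (size L) (seen col L).
Proof.
elim: L => [|U L IH] /=; first by exists [::].
case=> -[UU fU] lU /IH{}IH S N SC.
have FU : Filter U := filter_filter.
have : U ([set x | forall v, v \in S -> c v x = col] `&`
          ([set x | forall U', U' \in L -> toward U' x = col] `&` [set x | N <= x])).
  apply: filterI; last apply: filterI => //; apply: filter_all => //.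
  by move=> v /SC /(_ U (mem_head _ _)) <-; exact: towardP.
move=> /filter_ex[x [xS [xL Nx]]].
have [|K [uK sK NK SK cK]] := IH (x :: S) (maxn N x.+1).
  move=> v; rewrite inE => /predU1P[->|/SC vC U' U'L]; first exact: xL.
  by apply: vC; rewrite inE U'L orbT.
have gK y : y \in K -> x < y by move=> /NK; rewrite geq_max => /andP[].
exists (x :: K); split => /=.
- by rewrite uK andbT; apply/negP => /gK; rewrite ltnn.
- by rewrite sK.
- by move=> y; rewrite inE => /predU1P[->//|/NK]; rewrite geq_max => /andP[].
- move=> v y vS; rewrite inE => /predU1P[->|yK]; first exact: xS.
  by apply: SK => //; rewrite inE vS orbT.
move=> y z; rewrite !inE => /predU1P[->|yK] /predU1P[->|zK].
- by rewrite eqxx.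
- by move=> _; apply: SK => //; rewrite mem_head.
- by move=> _; rewrite c_sym; apply: SK => //; rewrite mem_head.
- exact: cK.
Qed.

(** Apply [chain_attached] to [m] repetitions of [U]. *)
Lemma self_linked_attached col m U : free U -> linked col U U ->
  clique_attached col m [set v | toward U v = col].
Proof.
move=> fU lU.
have ch : chain col (nseq m U).
  by elim: m => //= m IH; split => // U'; rewrite mem_nseq => /andP[_ /eqP ->].
have := chain_attached ch; rewrite size_nseq; apply: clique_attached_sub.
by move=> v /= Uv U'; rewrite mem_nseq => /andP[_ /eqP ->].
Qed.

Definition classified m D := exists (L : seq (bool * set nat)) (N0 : nat),
  (forall p, p \in L -> clique_attached p.1 m p.2) /\
  forall v, N0 <= v -> D v -> exists2 p, p \in L & p.2 v.

Lemma classified_step m D col C : clique_attached col m C ->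
  classified m (D `\` C) -> classified m D.
Proof.
move=> gC [L [N0 [gL cL]]]; exists ((col, C) :: L), N0; split.
  by move=> p; rewrite inE => /predU1P[->|/gL].
move=> v Nv Dv; case: (pselect (C v)) => Cv; first by exists (col, C); rewrite ?mem_head.
by have [//|p pL pv] := cL v Nv; exists p; rewrite ?inE ?pL ?orbT.
Qed.

Lemma classified_attached m D col : clique_attached col m D -> classified m D.
Proof.
by move=> gD; apply: (classified_step gD); exists [::], 0; split => // v _ [].
Qed.

(** The rest consists of the vertices that see the ultrafilters of [L] in color
    false and those of [R] in color true.  As long as it is unbounded, it carries
    a free ultrafilter [U].  The vertices that see [U] in the color in which [U]
    is linked to itself form a class, and [U] extends the chain of the other
    color.  A chain of length [m] makes the whole rest a class. *)
Lemma classified_rest m L R : chain false L -> chain true R ->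
  size L <= m -> size R <= m -> classified m (seen false L `&` seen true R).
Proof.
have [n] := ubnP ((m - size L) + (m - size R)).
elim: n L R => // n IH L R le_n cL cR sL sR.
set D := _ `&` _.
case: (leqP m (size L)) => mL.
  apply: (@classified_attached _ _ false); have -> : m = size L by apply/eqP; rewrite eqn_leq mL sL.
  by apply: clique_attached_sub (chain_attached cL) => v [].
case: (leqP m (size R)) => mR.
  apply: (@classified_attached _ _ true); have -> : m = size R by apply/eqP; rewrite eqn_leq mR sR.
  by apply: clique_attached_sub (chain_attached cR) => v [].
case: (pselect (forall N, exists2 x, N <= x & D x)) => [/free_on|/existsNP[N nN]]; last first.
  by exists [::], N; split => // v Nv Dv; case: nN; exists v.
case=> U [fU UD]; have [UU _] := fU.
have FU : Filter U := filter_filter.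
have [lU|lU] : linked true U U \/ linked false U U.
- have := towardP; rewrite /linked.
  have [?|H] := in_ultra_setVsetC [set x | toward U x = true] UU; first by left.
  by right; apply: filterS H => x /= /negP/negbTE.
- apply: (classified_step (self_linked_attached m fU lU)).
  have := IH (U :: L) R; rewrite /= => /(_ _ _ cR _ sR) H.
  have : classified m (seen false (U :: L) `&` seen true R).
    apply: H => //; first by lia.
    by split => // U' U'L; apply: filterS UD => x [xL _]; exact: xL.
  move=> [C [N0 [gC cC]]]; exists C, N0; split => // v Nv [[vL vR] vU].
  apply: cC => //; split => // U'; rewrite inE => /predU1P[->|/vL //].
  by apply/negbTE/negP.
- apply: (classified_step (self_linked_attached m fU lU)).
  have := IH L (U :: R); rewrite /= => /(_ _ cL _ sL) H.
  have : classified m (seen false L `&` seen true (U :: R)).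
    apply: H => //; first by lia.
    by split => // U' U'L; apply: filterS UD => x [_ xR]; exact: xR.
  move=> [C [N0 [gC cC]]]; exists C, N0; split => // v Nv [[vL vR] vU].
  apply: cC => //; split => // U'; rewrite inE => /predU1P[->|/vR //].
  by move: vU => /=; case: (toward U v).
Qed.

Lemma vertex_classes m : exists (q N0 : nat) (k : nat -> nat) (col : nat -> bool),
  (forall v, N0 <= v -> k v < q) /\
  forall i, i < q -> clique_attached (col i) m [set v | N0 <= v /\ k v = i].
Proof.
have [//|//|//|//|L [N0 [gL cL]]] := @classified_rest m [::] [::].
pose k v := find (fun p : bool * set nat => `[< p.2 v >]) L.
have kL v : N0 <= v -> k v < size L.
  move=> Nv; rewrite -has_find; have [|p pL pv] := cL v Nv; first by split.
  by apply/hasP; exists p => //; apply/asboolP.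
exists (size L), N0, k, (fun i => (nth (true, set0) L i).1); split => // i iL.
apply: clique_attached_sub (gL _ (mem_nth (true, set0) iL)) => v [Nv <-].
have hv : has (fun p : bool * set nat => `[< p.2 v >]) L by rewrite has_find; exact: kL.
by have /asboolP := nth_find (true, set0) hv.
Qed.

End VertexClasses.

(** * An upper bound on h from uncrossed points *)

Section StaircaseBound.
Local Open Scope classical_set_scope.
Context (R : realType) (lam kappa : R) (r beta : nat -> nat) (n0 : nat).
Context (u v u' v' : nat -> R).
Hypotheses (lam0 : 0 < lam) (kappa0 : 0 < kappa).
Hypothesis r_beta : forall n, (r n + beta n <= n)%N.
Hypotheses (u0 : forall n, 0 <= u n) (v'0 : forall n, 0 <= v' n).
Hypothesis v_beta : forall n, (n0 <= n)%N -> v n <= (beta n)%:R.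
Hypothesis u'_r : forall n, (n0 <= n)%N -> u' n <= (r n)%:R.
Hypothesis excess_v : forall n, (n0 <= n)%N -> kappa * n%:R <= v n - u n / lam.
Hypothesis excess_u' : forall n, (n0 <= n)%N -> kappa * n%:R <= u' n - v' n / lam.
Hypothesis uncrossed : forall n m, (n0 <= n)%N -> (n0 <= m)%N -> u' m <= u n \/ v n <= v' m.

(* With [x] the sum and [y] the difference of the coordinates, [y = corner n x]
   is the boundary of the open lower right quadrant with vertex [(u n, v n)].  The
   path [g] is the lowest 1-Lipschitz one that starts at the origin and avoids all
   these quadrants. *)
Let corner n x := u n - v n + `|x - (u n + v n)|.
Let candidates x := [set y | y = x \/ exists2 n, (n0 <= n)%N & y = corner n x].
Let g x := inf (candidates x).

Let candidates_lb x : 0 <= x -> has_inf (candidates x).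
Proof.
move=> x0; split; first by exists x; left.
exists (- x) => y [->|[n _ ->]]; first by lra.
rewrite /corner; have := ler_norm (- (x - (u n + v n))); rewrite normrN.
have := u0 n; lra.
Qed.

Let g_le x y : 0 <= x -> candidates x y -> g x <= y.
Proof. by move=> x0 xy; apply: ge_inf => //; exact: (candidates_lb x0).2. Qed.

Let g_ge x z : (forall y, candidates x y -> z <= y) -> z <= g x.
Proof. by move=> H; apply: lb_le_inf => //; exists x; left. Qed.

Let g_lip : 1.-lipschitz_(`[0, +oo[) g.
Proof.
apply/itv0_lipschitzP.
have half x y : 0 <= x -> 0 <= y -> g x - g y <= `|x - y|.
  move=> x0 y0; rewrite lerBlDl -lerBlDr; apply: g_ge => z [->|[n nn ->]].
    rewrite lerBlDr; apply: (@le_trans _ _ x); first by apply: g_le => //; left.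
    by rewrite -lerBlDl ler_norm.
  rewrite lerBlDr; apply: (@le_trans _ _ (corner n x)).
    by apply: g_le => //; right; exists n.
  rewrite /corner -[leRHS]addrA lerD2l addrC -{1}(subrK y x) -addrA.
  exact: ler_normD.
move=> x y x0 y0; rewrite ler_norml lerNl opprB half // andbT.
by rewrite distrC half.
Qed.

Let g_0 : g 0 = 0.
Proof.
apply/eqP; rewrite eq_le g_le ?lexx //=; last by left.
apply: g_ge => y [->//|[n _ ->]]; rewrite /corner sub0r normrN.
have := ler_norm (u n + v n); have := u0 n; lra.
Qed.

Let gamma : R := (lam - 1) / (lam + 1).

Let gammaE x : (1 + lam) * (gamma * x) = (lam - 1) * x.
Proof. by have l0 := lam0; rewrite /gamma; field; rewrite gt_eqF //; lra. Qed.

(* The path passes weakly to the left of [(u n, v n)], where [v - u / lam] is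
   large. *)
Let Gamma_minus_le n t : (n0 <= n)%N -> (1 + lam) * t <= 2 * lam * (kappa * n%:R) ->
  (Gamma_minus gamma g t <= (u n + v n)%:E)%E.
Proof.
move=> nn tn; have l0 := lam0; have ex := excess_v nn; have un := u0 n.
have ul0 : 0 <= u n / lam by rewrite divr_ge0 // ltW.
have kn : 0 <= kappa * n%:R by rewrite mulr_ge0 // ltW.
have x0 : 0 <= u n + v n by lra.
apply: ereal_inf_lbound; exists (u n + v n) => //; split => //.
have gle : g (u n + v n) <= u n - v n.
  by apply: g_le => //; right; exists n => //; rewrite /corner subrr normr0 addr0.
rewrite -(@ler_pM2l _ (1 + lam)); last by lra.
rewrite mulrBr gammaE.
have lu : lam * (u n / lam) = u n by rewrite mulrCA divff ?mulr1 // gt_eqF.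
have := ler_wpM2l (ltW lam0) ex; rewrite mulrBr lu => ex'.
have : (1 + lam) * g (u n + v n) <= (1 + lam) * (u n - v n) by rewrite ler_wpM2l //; lra.
lra.
Qed.

(* As no quadrant contains [(u' n, v' n)] in its interior, the path passes weakly
   below it, where [u - v / lam] is large. *)
Let Gamma_plus_le n t : (n0 <= n)%N -> (1 + lam) * t <= 2 * lam * (kappa * n%:R) ->
  (Gamma_plus gamma g t <= (u' n + v' n)%:E)%E.
Proof.
move=> nn tn; have l0 := lam0; have ex := excess_u' nn; have vn := v'0 n.
have ul0 : 0 <= v' n / lam by rewrite divr_ge0 // ltW.
have kn : 0 <= kappa * n%:R by rewrite mulr_ge0 // ltW.
have x0 : 0 <= u' n + v' n by lra.
apply: ereal_inf_lbound; exists (u' n + v' n) => //; split => //.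
have gle : u' n - v' n <= g (u' n + v' n).
  apply: g_ge => y [->|[m mm ->]]; first by lra.
  rewrite /corner; set d := _ - _; have := ler_norm d; have := ler_norm (- d).
  by rewrite normrN /d; case: (uncrossed mm nn); lra.
rewrite -(@ler_pM2l _ (1 + lam)); last by lra.
rewrite mulrDr gammaE.
have lu : lam * (v' n / lam) = v' n by rewrite mulrCA divff ?mulr1 // gt_eqF.
have := ler_wpM2l (ltW lam0) ex; rewrite mulrBr lu => ex'.
have : (1 + lam) * (u' n - v' n) <= (1 + lam) * g (u' n + v' n) by rewrite ler_wpM2l //; lra.
lra.
Qed.

Let X := (1 + lam) ^+ 2 / (2 * lam * kappa) - (1 + lam).

(** For each [t], the cuts at the least [n] with [2 * lam * kappa * n] above
    [(1 + lam) * t] bound [Gamma_plus] by [(1 + lam) * r n - lam * kappa * n] and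
    [Gamma_minus] by the same expression in [beta n]; the sum is linear in [n]
    because [r n + beta n <= n]. *)
Lemma staircase_bound : h gamma <= X.
Proof.
have l0 := lam0; have k0 := kappa0.
have gN1 : -1 < gamma by rewrite /gamma ltr_pdivlMr; lra.
have g1 : gamma < 1 by rewrite /gamma ltr_pdivrMr; lra.
rewrite -lee_fin /h fineK; last exact: h_ereal_fin_num.
apply/lee_addgt0Pr => e e0.
apply: ge_ereal_inf; exists (limf_esup
    (fun t : R => (Gamma_plus gamma g t + Gamma_minus gamma g t) * (t^-1)%:E)%E
    (pinfty_nbhs R)); first by exists g.
pose A := 1 + lam - 2 * lam * kappa.
pose T0 := `|A| / e + n0%:R * (2 * lam * kappa) / (1 + lam).
have T00 : 0 <= T0.
  by rewrite addr_ge0 ?divr_ge0 ?mulr_ge0 // ?ltW //; lra.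
apply: ge_ereal_inf; eexists; first by exists [set t | T0 < t] => //; exists T0; split => //; exact: num_real.
apply: ge_ereal_sup => _ [t /= Tt <-].
have t0 : 0 < t by apply: le_lt_trans Tt.
rewrite lee_pdivrMr // -EFinM.
have lk : 0 < 2 * lam * kappa by rewrite !mulr_gt0.
pose s := t * (1 + lam) / (2 * lam * kappa).
have s0 : 0 <= s by rewrite divr_ge0 ?mulr_ge0 ?ltW //; lra.
have /andP[n1 n2] := truncn_itv s0.
pose n := (Num.truncn s).+1.
have nn : (n0 <= n)%N.
  rewrite -(ler_nat R); apply: le_trans (ltW n2).
  rewrite /s ler_pdivlMr //; rewrite -ler_pdivrMr; last by lra.
  apply: le_trans (ltW Tt); rewrite /T0 lerDr divr_ge0 //; exact: ltW.
have tn : (1 + lam) * t <= 2 * lam * (kappa * n%:R).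
  by have := ltW n2; rewrite -/n /s ler_pdivrMr //; move: (n%:R : R) => nr; lra.
have ev := excess_v nn; have eu := excess_u' nn.
apply: (le_trans (leeD (Gamma_plus_le nn tn) (Gamma_minus_le nn tn))).
rewrite -EFinD lee_fin.
have nb : (r n)%:R + (beta n)%:R <= n%:R :> R by rewrite -natrD ler_nat.
have vb := v_beta nn; have ur := u'_r nn.
have lu : lam * (u n / lam) = u n by rewrite mulrCA divff ?mulr1 // gt_eqF.
have lv : lam * (v' n / lam) = v' n by rewrite mulrCA divff ?mulr1 // gt_eqF.
have := ler_wpM2l (ltW lam0) ev; rewrite mulrBr lu => ev'.
have := ler_wpM2l (ltW lam0) eu; rewrite mulrBr lv => eu'.
have b1 : (1 + lam) * (u' n + v n) <= (1 + lam) * n%:R by rewrite ler_wpM2l //; lra.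
have le_A : u' n + v' n + (u n + v n) <= A * n%:R by rewrite /A; lra.
apply: (le_trans le_A).
have n1' : n%:R <= s + 1 by rewrite /n -natr1 lerD2r.
have Ab : `|A| <= t * e.
  rewrite -ler_pdivrMr //; apply: le_trans (ltW Tt); rewrite /T0 lerDl.
  by rewrite divr_ge0 ?mulr_ge0 // ?ltW //; lra.
have XE : t * X = A * s by rewrite /X /A /s; field; rewrite !gt_eqF.
(* [A * n] bounds a sum of nonnegative quantities. *)
have A0 : 0 <= A.
  have un := u0 n; have vn := v'0 n.
  have kn0 : 0 <= kappa * n%:R by rewrite mulr_ge0 // ltW.
  have ? : 0 <= u n / lam by rewrite divr_ge0 // ltW.
  have ? : 0 <= v' n / lam by rewrite divr_ge0 // ltW.
  have : 0 <= A * n%:R by apply: le_trans le_A; lra.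
  by rewrite pmulr_lge0 // ltr0n.
apply: (@le_trans _ _ (A * (s + 1))); first by rewrite ler_wpM2l.
rewrite mulrDr mulr1 -XE (mulrC (X + e)) (mulrDr t X e) lerD2l.
by apply: le_trans Ab; rewrite ler_norm.
Qed.

End StaircaseBound.

(** * Cuts of different colors do not cross *)

Section Crossing.
Local Open Scope nat_scope.
Context (c : rel nat) (c_sym : symmetric c) (k : nat -> nat) (q : nat).

(** Large enough for one of [q] classes to contain a set to which
    [bipartite_ramsey] applies. *)
Definition crossing_const t := q.+1 * (2 ^ (2 * t) * t).

Lemma subset_of_size_take (T : eqType) r s X (P : {pred T}) : r <= s ->
  subset_of_size s X P -> subset_of_size r (take r X) P.
Proof.
move=> rs [uX sX XP]; split; first exact: take_uniq.
  by rewrite size_take_min sX; apply/minn_idPl.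
by move=> x /mem_take/XP.
Qed.

Lemma large_difference_class t (P U : seq nat) : 0 < t -> uniq P ->
  {in P, forall x, k x < q} -> size U + crossing_const t < size P ->
  exists P', [/\ uniq P', 2 ^ (2 * t) * t <= size P',
    {subset P' <= P}, {in P', forall x, x \notin U} & {in P' &, forall x y, k x = k y}].
Proof.
move=> t0 uP kP big; pose D := [seq x <- P | x \notin U].
have sD : crossing_const t <= size D.
  have le : size [seq x <- P | x \in U] <= size U.
    apply: uniq_leq_size; first exact: filter_uniq.
    by move=> x; rewrite mem_filter => /andP[].
  have E : size [seq x <- P | x \in U] + size D = size P.
    by rewrite /D !size_filter; exact: count_predC.
  by lia.
have [|||y sy] := @large_fiber 'I_q.+1 (fun x => inord (k x)) D (2 ^ (2 * t) * t).
- by rewrite muln_gt0 expn_gt0.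
- by rewrite card_ord.
- by rewrite -size_eq0 -lt0n; apply: leq_trans sD; rewrite !muln_gt0 expn_gt0.
exists [seq x <- D | inord (k x) == y]; split => //.
- by rewrite !filter_uniq.
- by move=> x; rewrite !mem_filter => /and3P[].
- by move=> x; rewrite !mem_filter => /and3P[].
move=> x x'; rewrite !mem_filter => /and3P[/eqP e1 _ xP] /and3P[/eqP e2 _ xP'].
have := congr1 val (etrans e1 (esym e2)).
by rewrite /= !inordK // ltnS ltnW // kP.
Qed.

Definition block_free col Z (Y0 : seq nat) r s (U Q : seq nat) :=
  forall X Y, block c col k Z Y0 r s X Y ->
    {in X, forall v, v \notin U} -> {subset Y <= Q} -> False.

(** Otherwise [Q false] outside [U true] and [Q true] outside [U false] both
    contain large parts of single classes, and a monochromatic complete bipartite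
    graph between these parts is a block forbidden by the cut of its color. *)
Lemma block_free_cross (Z : bool -> pred nat) (Y0 : bool -> seq nat) r s
    (U Q : bool -> seq nat) :
  0 < r -> (forall col, uniq (Q col)) ->
  (forall col, {subset Q col <= Y0 col}) ->
  (forall col, {in Y0 col, forall x, Z (~~ col) x /\ k x < q}) ->
  (forall col, block_free col (Z col) (Y0 col) r s (U col) (Q col)) ->
  size (Q false) <= size (U true) + crossing_const (r + s) \/
  size (Q true) <= size (U false) + crossing_const (r + s).
Proof.
move=> r0 uQ QY YZ bf; set C := crossing_const _.
case: (leqP (size (Q false)) (size (U true) + C)) => [|lt1]; first by left.
case: (leqP (size (Q true)) (size (U false) + C)) => [|lt2]; first by right.
have t0 : 0 < r + s by rewrite addn_gt0 r0.
have kQ col : {in Q col, forall x, k x < q} by move=> x /QY/YZ[].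
have [P1 [uP1 sP1 P1Q P1U kP1]] := large_difference_class t0 (uQ false) (@kQ false) lt1.
have [P2 [uP2 sP2 P2Q P2U kP2]] := large_difference_class t0 (uQ true) (@kQ true) lt2.
have le2 : 2 * (r + s) <= 2 ^ (2 * (r + s)) * (r + s).
  by rewrite leq_mul2r; apply/orP; right; rewrite -{1}(expn1 2) leq_exp2l // muln_gt0.
have [col [X [Y [[uX sX XP] [uY sY YP] XY]]]] :=
  bipartite_ramsey c t0 uP1 uP2 (leq_trans le2 sP1) sP2.
have sub1 x : x \in X -> [/\ x \in Q false, x \in P1 & x \notin U true].
  by move=> /XP xP; split => //; [exact: P1Q | exact: P1U].
have sub2 x : x \in Y -> [/\ x \in Q true, x \in P2 & x \notin U false].
  by move=> /YP xP; split => //; [exact: P2Q | exact: P2U].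
exfalso; case: col XY => XY.
  apply: (bf true (take r X) (take s Y)).
  - split.
    + apply: (@subset_of_size_take _ _ (r + s)); first exact: leq_addr.
      by split => // x /sub1[/QY/YZ[]].
    + by move=> x y /mem_take/sub1[_ ? _] /mem_take/sub1[_ ? _]; apply: kP1.
    + apply: (@subset_of_size_take _ _ (r + s)); first exact: leq_addl.
      by split => // x /sub2[/QY].
    + by move=> x y /mem_take xX /mem_take yY; apply: XY.
  - by move=> x /mem_take/sub1[].
  - by move=> x /mem_take/sub2[].
apply: (bf false (take r Y) (take s X)).
- split.
  + apply: (@subset_of_size_take _ _ (r + s)); first exact: leq_addr.
    by split => // x /sub2[/QY/YZ[]].
  + by move=> x y /mem_take/sub2[_ ? _] /mem_take/sub2[_ ? _]; apply: kP2.
  + apply: (@subset_of_size_take _ _ (r + s)); first exact: leq_addl.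
    by split => // x /sub1[/QY].
  + by move=> x y /mem_take xX /mem_take yY; rewrite c_sym; apply: XY.
- by move=> x /mem_take/sub2[].
- by move=> x /mem_take/sub1[].
Qed.

End Crossing.

(** * One of the two colors succeeds *)

Section TilingsExist.
Context (R : realType) (c : rel nat) (c_sym : symmetric c).
Context (q N0 : nat) (k : nat -> nat) (kcol : nat -> bool).
Hypothesis k_lt : forall x, (N0 <= x)%N -> (k x < q)%N.

Definition side col : pred nat := fun x => (N0 <= x)%N && (kcol (k x) == col).
Definition side_upto col n := [seq x <- iota 1 n | side col x].

(** Copies of color [col] can always cover the vertices whose class has that
    color, so the property concerns the vertices of the other color up to [n]. *)
Definition nearly_tiled (a b : nat) col n (kappa : R) :=
  exists Bl : seq (seq nat * seq nat),
  [/\ {in Bl, forall p, block c col k (side col) (side_upto (~~ col) n) b a p.1 p.2},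
      uniq (flatten [seq p.1 ++ p.2 | p <- Bl]) &
      (size (side_upto (~~ col) n))%:R <= kappa * n%:R + (a * size Bl)%:R].

Lemma side_disjoint col x : side (~~ col) x -> ~~ side col x.
Proof. by rewrite /side => /andP[-> /eqP ->]; case: col. Qed.

Lemma side_upto_sum n :
  (size (side_upto true n) + size (side_upto false n) <= n)%N.
Proof.
rewrite /side_upto !size_filter -[leqRHS](size_iota 1) -(count_predC (side true)).
by rewrite leq_add2l; apply: sub_count => x; apply: (@side_disjoint true).
Qed.

(** If both colors failed from [n0] on, [tiling_alternative] would produce cuts
    with excess close to [kappa * n], [block_free_cross] would keep them
    uncrossed up to a constant, and [staircase_bound] would contradict the lower
    bound on [h]. *)
Lemma nearly_tiled_often (a b : nat) (kappa kappa' : R) :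
  (0 < a)%N -> (0 < b)%N -> 0 < kappa' < kappa ->
  let lam : R := b%:R / a%:R in
  (1 + lam) ^+ 2 / (2 * lam * kappa') - (1 + lam) < h ((lam - 1) / (lam + 1)) ->
  forall n0, exists2 n, (n0 <= n)%N & exists col, nearly_tiled a b col n kappa.
Proof.
move=> a0 b0 /andP[k'0 kk'] lam hlt n0; apply: contrapT => none.
have fail n col : (n0 <= n)%N -> ~ nearly_tiled a b col n kappa.
  by move=> nn H; apply: none; exists n => //; exists col.
have aR : 0 < a%:R :> R by rewrite ltr0n.
have bR : 0 < b%:R :> R by rewrite ltr0n.
have an0 : a%:R != 0 :> R by rewrite gt_eqF.
have bn0 : b%:R != 0 :> R by rewrite gt_eqF.
have lam0 : 0 < lam by rewrite divr_gt0.
pose eps := (kappa - kappa') / 2.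
have eps0 : 0 < eps by rewrite /eps; lra.
(* The factor [(J + 2) / (J - 1)] lost by duality is [1 + 3 / J1]. *)
pose J1 := (Num.truncn (3 / eps)).+1; pose J := J1.+1.
have J1e : 3 / J1%:R <= eps.
  have /andP[_ lt3] := truncn_itv (divr_ge0 (ler0n R 3) (ltW eps0)).
  by rewrite ler_pdivrMr ?ltr0n // mulrC -ler_pdivrMr // ltW.
pose r := (J ^ 2 * b)%N; pose s := (J ^ 2 * a)%N.
have cuts : forall x : nat * bool, exists UQ : seq nat * seq nat,
    (n0 <= x.1)%N ->
    [/\ uniq UQ.2, {subset UQ.2 <= side_upto (~~ x.2) x.1},
        block_free c k x.2 (side x.2) (side_upto (~~ x.2) x.1) r s UQ.1 UQ.2 &
        (size UQ.2)%:R - (size UQ.1)%:R / lam >= (kappa - eps) * x.1%:R].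
  move=> [n col] /=.
  have uY : uniq (side_upto (~~ col) n) by rewrite filter_uniq ?iota_uniq.
  have YZ : {in side_upto (~~ col) n, forall x, ~~ side col x}.
    by move=> x; rewrite mem_filter => /andP[/side_disjoint].
  have [Bl [U [Q [bl uBl [uU uQ QY] cnt bf]]]] := tiling_alternative c col k a0 b0 (isT : 1 < J)%N uY YZ.
  exists (U, Q) => nn /=; split => //.
  set Y := side_upto _ _ in uY YZ QY bl bf cnt *.
  have big : kappa * n%:R + (a * size Bl)%:R < (size Y)%:R.
    by rewrite ltNge; apply/negP => le; apply: (fail n col nn); exists Bl.
  have Yn : (size Y <= n)%N.
    by rewrite /Y size_filter; apply: leq_trans (count_size _ _) _; rewrite size_iota.
  have QYs : (size Q <= size Y)%N by exact: uniq_leq_size.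
  have := cnt; rewrite -(ler_nat R) /J /=.
  rewrite !natrM !natrD !natrM natrB // => cntR.
  have e1 : (J1.+1%:R : R) = J1%:R + 1 by rewrite -natr1.
  move: cntR big; rewrite e1 natrM.
  have J10 : 0 < J1%:R :> R by rewrite ltr0n.
  have YnR : (size Y)%:R <= n%:R :> R by rewrite ler_nat.
  move: J1e J10; set j : R := J1%:R; set y : R := (size Y)%:R in YnR *.
  set u : R := (size U)%:R; set w : R := (size Q)%:R; set M : R := (size Bl)%:R.
  move=> J1e J10 cntR big.
  have nR : 0 <= n%:R :> R by rewrite ler0n.
  have M0 : 0 <= a%:R * M by rewrite mulr_ge0 ?ler0n.
  have kn0 : 0 <= kappa * n%:R by rewrite mulr_ge0 //; lra.
  have ul : b%:R * (u / lam) = a%:R * u by rewrite /lam; field; rewrite ?an0 ?bn0.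
  have : j * (u / lam + (y - w)) <= a%:R * M * (j + 3).
    rewrite -(ler_pM2l bR) mulrCA mulrDr ul.
    by apply: le_trans cntR _; rewrite le_eqVlt; apply/orP; left; apply/eqP; ring.
  rewrite mulrC -ler_pdivlMr // => H.
  have e2 : a%:R * M * (j + 3) / j = a%:R * M + a%:R * M * (3 / j).
    have jn0 : j != 0 by rewrite gt_eqF.
    by field; rewrite ?jn0.
  have : a%:R * M * (3 / j) <= n%:R * eps.
    apply: ler_pM => //; first by rewrite divr_ge0 // ltW.
    by lra.
  by rewrite e2 in H; lra.
have [UQ UQP] := choice cuts.
pose C := crossing_const q (r + s).
(* Beyond [m0], the constant [C] by which cuts may cross is absorbed in the excess. *)
pose m0 := maxn n0 (Num.truncn (C%:R / lam / eps)).+1.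
have m0C m : (m0 <= m)%N -> C%:R / lam <= eps * m%:R.
  rewrite geq_max => /andP[_ mC].
  have c0 : 0 <= C%:R / lam / eps :> R.
    by apply: divr_ge0; [apply: divr_ge0; [exact: ler0n | exact: ltW] | exact: ltW].
  have /andP[_ lt3] := truncn_itv c0.
  by rewrite [leRHS]mulrC -ler_pdivrMr //; apply: le_trans (ltW lt3) _; rewrite ler_nat.
pose su col n : R := (size (UQ (n, col)).1)%:R + C%:R.
pose sq col n : R := (size (UQ (n, col)).2)%:R.
have m0n m : (m0 <= m)%N -> (n0 <= m)%N by rewrite geq_max => /andP[].
have excess m col : (m0 <= m)%N -> kappa' * m%:R <= sq col m - su col m / lam.
  move=> mm; have [_ _ _ /= H] := UQP (m, col) (m0n _ mm).
  have := m0C _ mm; rewrite /su /sq mulrDl /eps in H *; lra.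
have szY m col : (m0 <= m)%N -> sq col m <= (size (side_upto (~~ col) m))%:R.
  move=> mm; have [uQ sub _ _] := UQP (m, col) (m0n _ mm).
  by rewrite ler_nat uniq_leq_size.
suff : h ((lam - 1) / (lam + 1)) <= (1 + lam) ^+ 2 / (2 * lam * kappa') - (1 + lam).
  by rewrite leNgt hlt.
apply: (@staircase_bound R lam kappa' (fun n => size (side_upto true n))
  (fun n => size (side_upto false n)) m0 (su true) (sq true) (sq false) (su false)) => //.
- exact: side_upto_sum.
- by move=> n; rewrite addr_ge0 ?ler0n.
- by move=> n; rewrite addr_ge0 ?ler0n.
- by move=> n nn; exact: szY.
- by move=> n nn; exact: (szY n false).
- by move=> n nn; exact: excess.
- by move=> n nn; exact: excess.
move=> n m nn mm; rewrite /su /sq -!natrD !ler_nat.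
pose ix (col : bool) := if col then n else m.
have ixn col : (n0 <= ix col)%N by case: col; exact: m0n.
have P col := UQP (ix col, col) (ixn col).
apply: (@block_free_cross c c_sym k q side (fun col => side_upto (~~ col) (ix col)) r s
  (fun col => (UQ (ix col, col)).1) (fun col => (UQ (ix col, col)).2)).
- by rewrite muln_gt0 b0 expn_gt0.
- by move=> col; have [] := P col.
- by move=> col; have [] := P col.
- move=> col x; rewrite mem_filter => /andP[sx _]; split => //.
  by apply: k_lt; case/andP: sx.
- by move=> col; have [] := P col.
Qed.

End TilingsExist.

(** * Extending partial copies of F *)

Section Copies.
Local Open Scope nat_scope.
Context (V : finType) (F : sgraph V) (c : rel nat) (c_sym : symmetric c) (col : bool).

Definition colored_copy (e : {ffun V -> nat}) :=
  forall u v, adj F u v -> c (e u) (e v) = col.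

Definition verts (E : seq {ffun V -> nat}) := flatten [seq codom (fun_of_fin e) | e <- E].

Lemma vertsP (E : seq {ffun V -> nat}) x :
  reflect (exists2 e : {ffun V -> nat}, e \in E & x \in codom e) (x \in verts E).
Proof.
apply: (iffP flattenP) => [[_ /mapP[e eE ->] xe]|[e eE xe]]; first by exists e.
by exists (codom e) => //; apply: map_f.
Qed.

Definition seed := ({set V} * {ffun V -> nat})%type.
Definition seed_verts (p : seed) := [seq p.2 v | v <- enum p.1].

(** The edges leaving the seed start at vertices placed in a single class, to
    which a far away clique can be attached for the rest of [F]. *)
Definition extendable (p : seed) :=
  {in p.1 &, forall u v, adj F u v -> c (p.2 u) (p.2 v) = col} /\
  exists2 C : set nat, clique_attached c col #|V| C &
    forall u v, u \in p.1 -> v \notin p.1 -> adj F u v -> C (p.2 u).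

Lemma extend_seed p M : extendable p -> uniq (seed_verts p) ->
  {in seed_verts p, forall x, x < M} ->
  exists e : {ffun V -> nat}, [/\ colored_copy e, uniq (codom e),
    {subset seed_verts p <= codom e} &
    {in codom e, forall x, x \in seed_verts p \/ M <= x}].
Proof.
case: p => D e0 [/= inD [C gC out]] uD ltM.
have [|K [uK sK MK SK cK]] := gC [seq x <- seed_verts (D, e0) | `[< C x >]] M.
  by move=> x; rewrite mem_filter => /andP[/asboolP].
pose e := [ffun v => if v \in D then e0 v else nth 0 K (enum_rank v)].
have rK (v : V) : enum_rank v < size K by rewrite sK ltn_ord.
have Kn (v : V) : nth 0 K (enum_rank v) \in K by apply: mem_nth.
have nth_inj (u v : V) : nth 0 K (enum_rank u) = nth 0 K (enum_rank v) -> u = v.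
  move/eqP; rewrite nth_uniq // => /eqP/val_inj; exact: enum_rank_inj.
have e0D v : v \in D -> e0 v \in seed_verts (D, e0).
  by move=> vD; apply/mapP; exists v; rewrite ?mem_enum.
have e0M v : v \in D -> e0 v < M by move=> /e0D/ltM.
have e0inj : {in D &, injective e0}.
  move=> u v uD' vD' euv.
  have iu : index u (enum D) < size (enum D) by rewrite index_mem mem_enum.
  have iv : index v (enum D) < size (enum D) by rewrite index_mem mem_enum.
  rewrite -(nth_index u (_ : u \in enum D)) ?mem_enum //.
  rewrite -[RHS](nth_index u (_ : v \in enum D)) ?mem_enum //; congr nth.
  apply/eqP; rewrite -(nth_uniq 0 _ _ uD) ?size_map //.
  by rewrite !(nth_map u) // !nth_index ?mem_enum // euv.
have eD u v : u \in D -> v \notin D -> adj F u v -> c (e u) (e v) = col.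
  move=> uD' vD uv; rewrite !ffunE uD' (negbTE vD); apply: SK => //.
  by rewrite mem_filter e0D // andbT; apply/asboolP/(out u v).
exists e; split.
- move=> u v uv; case: (boolP (u \in D)) => uD'; case: (boolP (v \in D)) => vD.
  + by rewrite !ffunE uD' vD; apply: inD.
  + exact: eD.
  + by rewrite c_sym; apply: eD => //; rewrite adj_sym.
  + rewrite !ffunE (negbTE uD') (negbTE vD); apply: cK => //.
    by apply: contraTneq uv => /nth_inj ->; rewrite adj_irrefl.
- apply/injectiveP => u v; rewrite !ffunE.
  case: ifP => uD'; case: ifP => vD.
  + exact: e0inj.
  + by move=> E; have := e0M _ uD'; rewrite E ltnNge MK.
  + by move=> E; have := e0M _ vD; rewrite -E ltnNge MK.
  + exact: nth_inj.
- move=> _ /mapP[v vD ->] /=; apply/codomP; exists v.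
  by rewrite ffunE -mem_enum vD.
- move=> _ /codomP[v ->]; rewrite ffunE; case: ifP => vD; first by left; apply: e0D.
  by right; apply: MK.
Qed.

(** Seeds are extended one after the other, each beyond everything used before;
    the new vertices avoid the later seeds because these lie below [M]. *)
Lemma extend_seeds ps M : {in ps, forall p, extendable p} ->
  uniq (flatten [seq seed_verts p | p <- ps]) ->
  {in ps, forall p, {in seed_verts p, forall x, x < M}} ->
  exists E : seq {ffun V -> nat},
  [/\ {in E, forall e, colored_copy e}, uniq (verts E),
    {in ps, forall p, {subset seed_verts p <= verts E}} &
    {in verts E, forall x, (exists2 p, p \in ps & x \in seed_verts p) \/ M <= x}].
Proof.
elim: ps M => [|p ps IH] M; first by exists [::].
move=> ok /=; rewrite cat_uniq => /and3P[up dis ups] ltM.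
have [|e [ce ue pe eM]] := extend_seed (ok p (mem_head _ _)) up (M := M).
  by apply: ltM; rewrite mem_head.
pose M' := maxn M (\max_(x <- codom e) x).+1.
have eM' x : x \in codom e -> x < M'.
  by move=> xe; rewrite leq_max; apply/orP; right; rewrite ltnS (@leq_bigmax_seq _ _ xpredT id x).
have [|//||E [cE uE pE EM]] := IH M'.
- by move=> p' p'ps; apply: ok; rewrite inE p'ps orbT.
- move=> p' p'ps x xp'; apply: leq_trans (leq_maxl _ _).
  by apply: (ltM p') => //; rewrite inE p'ps orbT.
exists (e :: E); split.
- by move=> e'; rewrite inE => /predU1P[->//|/cE].
- rewrite /verts /= cat_uniq ue uE andbT /=; apply/hasPn => x xE; apply/negP => xe.
  case: (EM x xE) => [[p' p'ps xp']|]; last by rewrite leqNgt eM'.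
  case: (eM x xe) => [xp|]; last first.
    by rewrite leqNgt (ltM p') // inE p'ps orbT.
  move/hasPn: dis => /(_ x); rewrite xp => /(_ _)/negP; apply=> //.
  by apply/flattenP; exists (seed_verts p') => //; apply: map_f.
- move=> p'; rewrite inE => /predU1P[->|p'ps] x xp'; rewrite /verts /= mem_cat.
    by rewrite pe.
  by rewrite (pE p') ?orbT.
move=> x; rewrite /verts /= mem_cat => /orP[/eM[xp|]|/EM[[p' p'ps xp']|M'x]].
- by left; exists p; rewrite ?mem_head.
- by right.
- by left; exists p'; rewrite ?inE ?p'ps ?orbT.
- by right; apply: leq_trans M'x; apply: leq_maxl.
Qed.

End Copies.

(** * Copies of F from packings *)

Section Stage.
Local Open Scope nat_scope.
Context (V : finType) (F : sgraph V) (I : {set V}).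
Hypothesis I_dind : doubly_independent F I.
Context (c : rel nat) (c_sym : symmetric c) (q N0 : nat) (k : nat -> nat) (kcol : nat -> bool).
Hypothesis k_lt : forall x, N0 <= x -> k x < q.
Hypothesis classes : forall i, i < q ->
  clique_attached c (kcol i) #|V| [set v | N0 <= v /\ k v = i]%classic.

Local Notation N := (nbhd F I).
Local Notation side := (side N0 k kcol).
Local Notation side_upto := (side_upto N0 k kcol).

Definition tile_seed (p : seq nat * seq nat) : seed V :=
  (N :|: I, [ffun v => if v \in N then nth 0 p.1 (index v (enum N))
                       else nth 0 p.2 (index v (enum I))]).

Lemma map_nth_index (s : seq V) (X : seq nat) : uniq s -> size s = size X ->
  [seq nth 0 X (index v s) | v <- s] = X.
Proof.
move=> us sX; apply: (@eq_from_nth _ 0); rewrite size_map // => i iX.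
case: s us sX iX => // x s us sX iX.
by rewrite (nth_map x) // index_uniq.
Qed.

Lemma tile_seed_verts p : size p.1 = #|N| -> size p.2 = #|I| ->
  perm_eq (seed_verts (tile_seed p)) (p.1 ++ p.2).
Proof.
move=> s1 s2.
have notN v : v \in I -> v \notin N by move=> vI; rewrite !inE vI.
have pe : perm_eq (enum (N :|: I)) (enum N ++ enum I).
  apply: uniq_perm; first exact: enum_uniq.
    rewrite cat_uniq !enum_uniq andbT /=; apply/hasPn => v.
    by rewrite !mem_enum => /notN.
  by move=> v; rewrite mem_cat !mem_enum finset.in_setU.
have E1 : [seq (tile_seed p).2 v | v <- enum N] = p.1.
  rewrite -[RHS](@map_nth_index (enum N)) ?enum_uniq -?cardE //.
  by apply/eq_in_map => v; rewrite mem_enum ffunE => ->.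
have E2 : [seq (tile_seed p).2 v | v <- enum I] = p.2.
  rewrite -[RHS](@map_nth_index (enum I)) ?enum_uniq -?cardE //.
  by apply/eq_in_map => v; rewrite mem_enum ffunE => /notN/negbTE ->.
by rewrite /seed_verts (permPl (perm_map _ pe)) map_cat E1 E2.
Qed.

(** By double independence, the edges of [F] inside [nbhd F I :|: I] join its two
    parts, hence are provided by the block; edges leaving this set start in
    [nbhd F I], which is placed in a single class. *)
Lemma tile_seed_extendable col Y0 p : 0 < #|N| ->
  block c col k (side col) Y0 #|N| #|I| p.1 p.2 -> extendable F c col (tile_seed p).
Proof.
move=> N0'; case: p => X Y /= [[uX sX XZ] kX [uY sY YY0] XY].
have [indI indN] := I_dind.
have eN v : v \in N -> (tile_seed (X, Y)).2 v \in X.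
  by move=> vN; rewrite ffunE vN; apply: mem_nth; rewrite sX cardE index_mem mem_enum.
have eI v : v \in I -> (tile_seed (X, Y)).2 v \in Y.
  move=> vI; rewrite ffunE [v \in N](_ : _ = false) /=; last by rewrite !inE vI.
  by apply: mem_nth; rewrite sY cardE index_mem mem_enum.
split=> [u v|].
  rewrite !finset.in_setU => /orP[uN|uI] /orP[vN|vI] uv.
  - by have := indN _ _ uN vN; rewrite uv.
  - by apply: XY; [apply: eN | apply: eI].
  - by rewrite c_sym; apply: XY; [apply: eN | apply: eI].
  - by have := indI _ _ uI vI; rewrite uv.
have [x0 x0X] : exists x0, x0 \in X.
  by case: (X) sX => [/esym/eqP|x ? _]; [rewrite -leqn0 leqNgt N0' | exists x; rewrite mem_head].
have [x0N /eqP x0c] : N0 <= x0 /\ kcol (k x0) == col by apply/andP/XZ.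
exists [set v | N0 <= v /\ k v = k x0]%classic.
  by rewrite -x0c; apply: classes; apply: k_lt.
move=> u v; rewrite !finset.in_setU negb_or => /orP[uN|uI] /andP[vN vI] uv.
  split; last by apply: kX; rewrite ?eN.
  by case/andP: (XZ _ (eN _ uN)).
case/negP: vN; rewrite !inE vI /=; apply/bigcupP; exists u => //.
by rewrite inE.
Qed.

Definition vertex_seed (v0 : V) x : seed V := ([set v0], [ffun=> x]).

Lemma vertex_seed_verts v0 x : seed_verts (vertex_seed v0 x) = [:: x].
Proof. by rewrite /seed_verts /= enum_set1 /= ffunE. Qed.

Lemma vertex_seed_extendable col v0 x : side col x ->
  extendable F c col (vertex_seed v0 x).
Proof.
case/andP => xN /eqP xc; split => [u v /set1P -> /set1P ->|]; first by rewrite adj_irrefl.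
exists [set v | N0 <= v /\ k v = k x]%classic => [|u v _ _ _ /=].
  by rewrite -xc; apply: classes; apply: k_lt.
by rewrite ffunE.
Qed.

Lemma perm_flatten_map (A : eqType) (f g : A -> seq nat) (s : seq A) :
  {in s, forall p, perm_eq (f p) (g p)} ->
  perm_eq (flatten (map f s)) (flatten (map g s)).
Proof.
elim: s => //= p s IH H; apply: perm_cat; first by apply: H; rewrite mem_head.
by apply: IH => p' p's; apply: H; rewrite inE p's orbT.
Qed.

Lemma flatten_uniq_filter (A : Type) (f : A -> seq nat) (P : pred A) (s : seq A) :
  uniq (flatten (map f s)) -> uniq (flatten [seq f p | p <- s & P p]).
Proof.
move=> u; apply: subseq_uniq u; elim: s => //= p s IH.
case: (P p) => /=; first by apply: cat_subseq.
by apply: subseq_trans IH (suffix_subseq _ _).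
Qed.

(** Disjoint blocks meeting [[0, M[] contain distinct vertices of it. *)
Lemma few_low_blocks (Bl : seq (seq nat * seq nat)) M :
  uniq (flatten [seq p.1 ++ p.2 | p <- Bl]) ->
  size Bl <= size [seq p <- Bl | all (leq M) (p.1 ++ p.2)] + M.
Proof.
move=> uBl; rewrite size_filter -(count_predC (fun p => all (leq M) (p.1 ++ p.2)) Bl) leq_add2l.
apply: (@leq_trans (count (fun x => x < M) (flatten [seq p.1 ++ p.2 | p <- Bl]))).
  elim: Bl {uBl} => //= p Bl IH; rewrite [in leqRHS]count_cat; apply: leq_add IH.
  case: (boolP (all _ _)) => //= /allPn[x xp xM].
  by rewrite -has_count; apply/hasP; exists x; rewrite // ltnNge.
rewrite -size_filter -[leqRHS](size_iota 0); apply: uniq_leq_size; first exact: filter_uniq.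
by move=> x; rewrite mem_filter mem_iota => /andP[].
Qed.

Lemma size_flatten_const (T : Type) (ss : seq (seq T)) r :
  all (fun s => size s == r) ss -> size (flatten ss) = r * size ss.
Proof.
elim: ss => [|s ss IH] /=; first by rewrite muln0.
by case/andP => /eqP sr /IH; rewrite size_cat sr mulnS => ->.
Qed.

Lemma side_upto_cover col n :
  n <= N0 + (size (side_upto col n) + size (side_upto (~~ col) n)).
Proof.
rewrite -{1}(size_iota 1 n) -(count_predC (fun x => x < N0)); apply: leq_add.
  rewrite -size_filter -[leqRHS](size_iota 0); apply: uniq_leq_size.
    by rewrite filter_uniq ?iota_uniq.
  by move=> x; rewrite mem_filter => /andP[lt _]; rewrite mem_iota.
rewrite /side_upto !size_filter -count_predUI; apply: leq_trans (leq_addr _ _).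
apply: sub_count => x /=; rewrite -leqNgt /side => -> /=.
by case: (kcol (k x)); case: (col).
Qed.

(** The seeds are the blocks lying beyond [M], and one seed for each remaining
    vertex beyond [M] whose class has color [col].  The error term accounts for
    the vertices without a class and for the blocks and vertices below [M]. *)
Lemma copies_from_tiling (R : realType) col n (kappa : R) M (v0 : V) : 0 < #|N| ->
  nearly_tiled c N0 k kcol #|I| #|N| col n kappa ->
  exists E : seq {ffun V -> nat},
  [/\ {in E, forall e, colored_copy F c col e}, uniq (verts E),
      {in verts E, forall x, M <= x} &
      (n%:R <= kappa * n%:R + (count (mem (verts E)) (iota 1 n) + (N0 + M * #|I|.+1))%:R)%R].
Proof.
move=> N_gt0 [Bl [bl uBl cnt]].
pose Bl' := [seq p <- Bl | all (leq M) (p.1 ++ p.2)].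
pose T := flatten [seq p.1 ++ p.2 | p <- Bl'].
pose Sg := [seq x <- side_upto col n | (M <= x) && (x \notin T)].
have bl' : {in Bl', forall p, block c col k (side col) (side_upto (~~ col) n) #|N| #|I| p.1 p.2}.
  by move=> p; rewrite mem_filter => /andP[_]; apply: bl.
have uT : uniq T by apply: flatten_uniq_filter.
have uSg : uniq Sg by rewrite !filter_uniq ?iota_uniq.
have TM x : x \in T -> M <= x.
  by move=> /flattenP[_ /mapP[p + ->]]; rewrite mem_filter => /andP[/allP H _] /H.
pose ps := map tile_seed Bl' ++ map (vertex_seed v0) Sg.
have tileP p : p \in Bl' -> perm_eq (seed_verts (tile_seed p)) (p.1 ++ p.2).
  by move=> /bl'[[_ s1 _] _ [_ s2 _] _]; apply: tile_seed_verts.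
have pps : perm_eq (flatten [seq seed_verts p | p <- ps]) (T ++ Sg).
  rewrite map_cat flatten_cat -!map_comp; apply: perm_cat.
    by apply: perm_flatten_map => p /tileP.
  rewrite (eq_map (g := fun x => [:: x])); last by move=> x; rewrite /= vertex_seed_verts.
  by rewrite flatten_map1 map_id.
have psP x : (x \in flatten [seq seed_verts p | p <- ps]) = (x \in T ++ Sg).
  exact: perm_mem.
pose M' := maxn M (\max_(x <- T ++ Sg) x).+1.
have [|||E [cE uE psE EM]] := @extend_seeds V F c c_sym col ps M'.
- move=> p; rewrite mem_cat => /orP[/mapP[p' p'B ->]|/mapP[x xS ->]].
    exact: tile_seed_extendable N_gt0 (bl' _ p'B).
  apply: vertex_seed_extendable.
  by move: xS; rewrite !mem_filter => /and3P[].
- rewrite (perm_uniq pps) cat_uniq uT uSg andbT; apply/hasPn => x.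
  by rewrite mem_filter => /andP[/andP[]].
- move=> p pps' x xp; rewrite leq_max; apply/orP; right; rewrite ltnS.
  rewrite (@leq_bigmax_seq _ _ xpredT id x) // -psP.
  by apply/flattenP; exists (seed_verts p) => //; apply: map_f.
have inE x : x \in T ++ Sg -> x \in verts E.
  by rewrite -psP => /flattenP[_ /mapP[p pin ->]]; exact: psE.
exists E; split => //.
  move=> x /EM[[p pin xp]|]; last by apply: leq_trans; apply: leq_maxl.
  have : x \in T ++ Sg by rewrite -psP; apply/flattenP; exists (seed_verts p) => //; apply: map_f.
  by rewrite mem_cat => /orP[/TM//|]; rewrite mem_filter => /andP[/andP[]].
pose W1 := [seq x <- side_upto col n | M <= x].
pose W2 := flatten (unzip2 Bl').
have W2Y x : x \in W2 -> x \in side_upto (~~ col) n.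
  by move=> /flattenP[_ /mapP[p /bl'[_ _ [_ _ pY] _] ->]]; exact: pY.
have uW2 : uniq W2.
  by move: uT; rewrite (perm_uniq (perm_flatten_pairs _)) cat_uniq => /and3P[].
have sW2 : size W2 = #|I| * size Bl'.
  rewrite /W2 (@size_flatten_const _ _ #|I|) ?size_map //; apply/allP => _ /mapP[p /bl'[_ _ [_ sp _] _] ->].
  by rewrite sp.
have uW : uniq (W1 ++ W2).
  rewrite cat_uniq uW2 !filter_uniq ?iota_uniq // andbT /=; apply/hasPn => x /W2Y.
  rewrite mem_filter => /andP[/side_disjoint nx _].
  by rewrite !mem_filter (negbTE nx) andbF.
have sW : size W1 + size W2 <= count (mem (verts E)) (iota 1 n).
  rewrite -size_cat -size_filter; apply: uniq_leq_size => // x; rewrite mem_cat mem_filter.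
  case/orP => [|xW].
    rewrite !mem_filter => /and3P[Mx sx xi]; rewrite xi andbT; apply: inE.
    rewrite mem_cat; case: (boolP (x \in T)) => //= xT.
    by rewrite !mem_filter Mx xT sx xi.
  have := W2Y _ xW; rewrite !mem_filter => /andP[_ ->]; rewrite andbT; apply: inE.
  rewrite mem_cat; apply/orP; left.
  have /flattenP[_ /mapP[p pB ->] xp] := xW.
  by apply/flattenP; exists (p.1 ++ p.2); [apply: map_f | rewrite mem_cat xp orbT].
have sW1 : size (side_upto col n) <= size W1 + M.
  rewrite -(count_predC (fun x => M <= x) (side_upto col n)) size_filter leq_add2l.
  rewrite -size_filter -[leqRHS](size_iota 0); apply: uniq_leq_size.
    by rewrite !filter_uniq ?iota_uniq.
  by move=> x; rewrite mem_filter /= -ltnNge => /andP[lt _]; rewrite mem_iota.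
have low := few_low_blocks M uBl; rewrite -/Bl' in low.
have lowa := leq_mul (leqnn #|I|) low.
have cov := side_upto_cover col n.
have : n + #|I| * size Bl <= size (side_upto (~~ col) n)
    + (count (mem (verts E)) (iota 1 n) + (N0 + M * #|I|.+1)).
  rewrite mulnDr in lowa; rewrite mulnS [M * #|I|]mulnC.
  move: lowa sW sW1 cov; rewrite sW2; move: (#|I| * _) (#|I| * _) (#|I| * M); lia.
rewrite -(ler_nat R) !natrD => H; move: cnt; lra.
Qed.

End Stage.

(** * Infinitely many copies *)

Lemma limn_esup_ge (R : realType) (u : nat -> \bar R) (l : \bar R) :
  (forall N, exists2 n, (N <= n)%N & (l <= u n)%E) -> (l <= limn_esup u)%E.
Proof.
move=> H; apply: le_ereal_inf_tmp => _ [A [N _ NA] <-].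
have [n Nn lu] := H N; apply: le_trans lu _.
by apply: ereal_sup_ubound; exists n => //; apply: NA.
Qed.

Section Assembly.
Context (R : realType) (V : finType) (F : sgraph V) (c : rel nat) (col : bool) (l : R).

Lemma uniq_verts_inj (E : seq {ffun V -> nat}) e0 i j u v :
  uniq (verts E) -> (i < size E)%N -> (j < size E)%N ->
  nth e0 E i u = nth e0 E j v -> i = j /\ u = v.
Proof.
elim: E i j => // e E IH i j; rewrite /verts /= cat_uniq => /and3P[ue dis uE].
have sep w i' (z : V) : (i' < size E)%N -> e w = nth e0 E i' z -> False.
  move=> iE ew; move/hasPn: dis => /(_ (e w)) H; have /negP[] : e w \notin codom e.
    by apply: H; rewrite ew; apply/vertsP; exists (nth e0 E i'); [apply: mem_nth | apply: codom_f].
  exact: codom_f.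
case: i j => [|i] [|j] //=.
- by move=> _ _ euv; split => //; move/injectiveP: ue; apply.
- by move=> _ jE /sep -/(_ jE).
- by move=> iE _ /esym/sep -/(_ iE).
by move=> iE jE /IH[] // -> ->.
Qed.

Hypothesis stages : forall M : nat, exists (n : nat) (E : seq {ffun V -> nat}),
  [/\ (M <= n)%N /\ E != [::], {in E, forall e, colored_copy F c col e}, uniq (verts E),
      {in verts E, forall x, (M <= x)%N} &
      l * n%:R <= (count (mem (verts E)) (iota 1 n))%:R].

(** Each stage takes place beyond all vertices of the previous ones, and the
    density reached at its own [n] is not affected by the later stages. *)
Lemma copies_assembled : exists K : subgraphKN,
  [/\ monochromatic c K, isomorphic_to (omega_copies F) K &
      (l%:E <= upper_density R (sub_vert K))%E].
Proof.
have /choice[st stP] : forall M : nat, exists p : nat * seq {ffun V -> nat},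
  [/\ (M <= p.1)%N /\ p.2 != [::], {in p.2, forall e, colored_copy F c col e}, uniq (verts p.2),
      {in verts p.2, forall x, (M <= x)%N} &
      l * p.1%:R <= (count (mem (verts p.2)) (iota 1 p.1))%:R].
  by move=> M; have [n [E H]] := stages M; exists (n, E).
pose bound (E : seq {ffun V -> nat}) := (maxn (size E) (\max_(x <- verts E) x)).+1.
have bound_gt E x : x \in verts E -> (x < bound E)%N.
  by move=> xE; rewrite ltnS leq_max (@leq_bigmax_seq _ _ xpredT id x) ?orbT.
pose A := fix A i := if i is j.+1 then A j ++ (st (bound (A j))).2 else [::].
have vcat E E' : verts (E ++ E') = verts E ++ verts E' by rewrite /verts map_cat flatten_cat.
have sA i : (i <= size (A i))%N.
  elim: i => //= i IH; rewrite size_cat; have [[_ ne] _ _ _ _] := stP (bound (A i)).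
  by rewrite -addn1 leq_add // lt0n size_eq0.
have uA i : uniq (verts (A i)).
  elim: i => //= i IH; have [_ _ uE ME _] := stP (bound (A i)).
  rewrite vcat cat_uniq IH uE andbT /=; apply/hasPn => x /ME le.
  by apply/negP => /bound_gt; rewrite ltnNge le.
have cA i : {in A i, forall e, colored_copy F c col e}.
  elim: i => //= i IH e; have [_ cE _ _ _] := stP (bound (A i)).
  by rewrite mem_cat => /orP[/IH|/cE].
have pA i : {in verts (A i), forall x, (0 < x)%N}.
  elim: i => //= i IH x; have [_ _ _ ME _] := stP (bound (A i)).
  by rewrite vcat mem_cat => /orP[/IH //|/ME]; apply: leq_trans.
pose z : {ffun V -> nat} := [ffun=> 0%N].
have nthA i j m : (i <= j)%N -> (m < size (A i))%N -> nth z (A j) m = nth z (A i) m.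
  move=> /subnK <-; elim: (j - i)%N => //= d IH mi.
  rewrite nth_cat IH //; case: ifP => // /negP[]; apply: leq_trans mi _.
  by elim: (d) => //= d' H; rewrite size_cat; apply: leq_trans H (leq_addr _ _).
pose e m := nth z (A m.+1) m.
have eA i m : (m < i)%N -> nth z (A i) m = e m.
  by move=> mi; apply: nthA => //; apply: sA.
have eAs i m : (m < size (A i))%N -> nth z (A i) m = e m.
  move=> mi; case: (leqP m.+1 i) => [/eA //|im].
  by rewrite /e (nthA i m.+1) // ltnW.
have e_in m : e m \in A m.+1 by apply: mem_nth; apply: sA.
pose phi (p : nat * V) := e p.1 p.2.
have phi_inj : injective phi.
  move=> [i u] [j v]; rewrite /phi /= => euv.
  have := @uniq_verts_inj (A (maxn i j).+1) z i j u v (uA _).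
  have le m : (m <= maxn i j)%N -> (m < size (A (maxn i j).+1))%N by move=> mm; apply: leq_trans (sA _).
  by rewrite !eA ?ltnS ?leq_maxl ?leq_maxr // !le ?leq_maxl ?leq_maxr // => /(_ isT isT euv)[-> ->].
pose ed x y := `[< exists i u v, [/\ x = phi (i, u), y = phi (i, v) & adj F u v] >].
have ed_sym : symmetric ed.
  move=> x y; apply/asboolP/asboolP => -[i [u [v [-> -> uv]]]];
    by exists i, v, u; split => //; rewrite adj_sym.
have ed_irr : irreflexive ed.
  move=> x; apply/negP => /asboolP[i [u [v [-> /phi_inj[<-]]]]].
  by rewrite adj_irrefl.
have pos x : range phi x -> (0 < x)%N.
  move=> [[i v] _ <-]; apply: (pA i.+1); apply/vertsP; exists (e i) => //.
  exact: codom_f.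
have ed_vert x y : ed x y -> range phi x.
  by move=> /asboolP[i [u [v [-> _ _]]]]; exists (i, u).
exists (SubgraphKN pos ed_sym ed_irr ed_vert); split => /=.
- exists col => x y /asboolP[i [u [v [-> -> uv]]]].
  by apply: (cA i.+1); first exact: e_in.
- exists phi; split.
    by split => [p _|p q _ _|x //]; [exists p | apply: phi_inj].
  move=> [i u] [j v] /=; rewrite /ed /copies_adj /=; apply/asboolP/idP.
    by move=> [i' [u' [v' [/phi_inj[-> ->] /phi_inj[-> ->] uv]]]]; rewrite eqxx.
  by move=> /andP[/eqP <- uv]; exists i, u, v.
apply: limn_esup_ge => N; set E := (st (bound (A N))).
have [[bn _] _ _ _ cnt] := stP (bound (A N)).
exists E.1.
  apply: leq_trans bn; apply: leq_trans (sA N) _.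
  by rewrite /bound ltnW // ltnS leq_maxl.
have n0 : (0 < E.1)%N by apply: leq_trans bn.
rewrite lee_fin ler_pdivlMr ?ltr0n //; apply: (le_trans cnt); rewrite ler_nat.
apply: sub_count => x /= xE; apply/mem_set.
have /vertsP[e' e'E /codomP[v ->]] : x \in verts (A N.+1) by rewrite /= vcat mem_cat xE orbT.
exists (index e' (A N.+1), v) => //.
by rewrite /phi /= -(eAs N.+1) ?index_mem // nth_index.
Qed.

End Assembly.

(** * The lower bound *)

(** A 1-Lipschitz function vanishing at 0 stays below the identity in absolute
    value, so both thresholds are at least [t / (1 + gamma)].  The main use is
    [f lam >= 1 / 2]: the copies of [F] to be found have positive density. *)
Lemma h_ge (R : realType) (gamma : R) : -1 < gamma -> gamma < 1 ->
  2 / (1 + gamma) <= h gamma.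
Proof.
move=> gN1 g1; have p1 : 0 < 1 + gamma by lra.
rewrite -lee_fin /h fineK; last exact: h_ereal_fin_num.
apply: le_ereal_inf_tmp => _ [g [glip g0] <-].
have gx x : 0 <= x -> g x <= x /\ - g x <= x.
  move=> x0; have /itv0_lipschitzP/(_ x 0 x0 (lexx 0)) := glip.
  by rewrite g0 !subr0 (ger0_norm x0) ler_norml => /andP[]; lra.
have GP t : ((t / (1 + gamma))%:E <= Gamma_plus gamma g t)%E.
  apply: le_ereal_inf_tmp => _ [x [x0 tx] <-]; rewrite lee_fin ler_pdivrMr //.
  by have [? _] := gx x x0; lra.
have GM t : ((t / (1 + gamma))%:E <= Gamma_minus gamma g t)%E.
  apply: le_ereal_inf_tmp => _ [x [x0 tx] <-]; rewrite lee_fin ler_pdivrMr //.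
  by have [_ ?] := gx x x0; lra.
apply: le_ereal_inf_tmp => _ [A [B [_ BA]] <-].
pose t := `|B| + 1.
have t0 : 0 < t by rewrite /t; have := normr_ge0 B; lra.
apply: (@le_trans _ _ ((Gamma_plus gamma g t + Gamma_minus gamma g t) * (t^-1)%:E)%E).
  rewrite lee_pdivlMr // -EFinM; apply: le_trans (leeD (GP t) (GM t)).
  by rewrite -EFinD lee_fin le_eqVlt; apply/orP; left; apply/eqP; field; rewrite gt_eqF.
apply: ereal_sup_ubound; exists t => //; apply: BA.
by rewrite /t; have := ler_norm B; lra.
Qed.

Section Edgeless.
Context (R : realType) (V : finType) (F : sgraph V).

(** Any bijection between the vertices of [omega_copies F] and the positive
    integers is an embedding. *)
Lemma edgeless_density (v0 : V) : (forall u v, ~~ adj F u v) ->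
  (1%:E <= ramsey_upper_density R (omega_copies F))%E.
Proof.
move=> noadj; apply: ereal_sup_ubound; exists 1 => //= c c_sym.
pose phi (p : nat * V) := (p.1 * #|V| + enum_rank p.2).+1.
have V0 : (0 < #|V|)%N by apply/card_gt0P; exists v0.
have phi_inj : injective phi.
  move=> [i u] [j v] [E].
  have := congr1 (divn^~ #|V|) E; have := congr1 (modn^~ #|V|) E.
  rewrite /= !modnMDl !modn_small // !divnMDl // !divn_small // !addn0.
  by move=> /val_inj/enum_rank_inj -> ->.
have phi_surj x : (0 < x)%N -> exists p, phi p = x.
  case: x => // x _; have lt : (x %% #|V| < #|V|)%N by rewrite ltn_mod.
  exists ((x %/ #|V|)%N, enum_val (Ordinal lt)).
  by rewrite /phi /= enum_valK /= -divn_eq.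
have pos (x : nat) : [set x : nat | (0 < x)%N]%classic x -> (0 < x)%N by [].
pose K := @SubgraphKN [set x : nat | (0 < x)%N]%classic (fun _ _ => false) pos
  (fun _ _ => erefl) (fun _ => erefl) (fun x y (H : false) => False_ind _ (notF H)).
exists K; split.
- by exists true.
- exists phi; split.
    split => [p _ //|p q _ _|x /= /phi_surj[p <-]]; first exact: phi_inj.
    by exists p.
  by move=> u v /=; rewrite /copies_adj (negbTE (noadj _ _)) andbF.
apply: limn_esup_ge => N; exists N.+1 => //.
rewrite lee_fin (_ : count _ _ = N.+1) ?divff ?pnatr_eq0 //.
rewrite -[RHS](size_iota 1); apply/eqP; rewrite -all_count; apply/allP => x.
by rewrite mem_iota => /andP[x0 _]; apply/mem_set.
Qed.

End Edgeless.

Section MainBound.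
Context (R : realType) (V : finType) (F : sgraph V) (I : {set V}).
Hypothesis I_dind : doubly_independent F I.

(** One color is nearly tiled for infinitely many [n].  A fixed loss, such as that
    caused by the vertices used in previous stages, is absorbed by the gap
    between [kappa'] and [kappa]. *)
Lemma density_from_gap (kappa' kappa : R) (c : rel nat) : symmetric c ->
  (0 < #|I|)%N -> (0 < #|nbhd F I|)%N -> 0 < kappa' < kappa -> kappa < 1 ->
  let lam : R := #|nbhd F I|%:R / #|I|%:R in
  (1 + lam) ^+ 2 / (2 * lam * kappa') - (1 + lam) < h ((lam - 1) / (lam + 1)) ->
  exists K : subgraphKN, [/\ monochromatic c K, isomorphic_to (omega_copies F) K &
        ((1 - kappa)%:E <= upper_density R (sub_vert K))%E].
Proof.
move=> c_sym a0 b0 /andP[k'0 kk'] k1 lam hlt.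
have [q [N0 [k [kcol [k_lt classes]]]]] := vertex_classes c_sym #|V|.
pose kappa1 := (kappa' + kappa) / 2.
have k'k1 : 0 < kappa' < kappa1 by apply/andP; split; rewrite // /kappa1; lra.
have often := nearly_tiled_often c_sym kcol k_lt a0 b0 k'k1 hlt.
have [col colP] : exists col, forall n0, exists2 n, (n0 <= n)%N &
    nearly_tiled c N0 k kcol #|I| #|nbhd F I| col n kappa1.
  apply: contrapT => /forallNP none.
  have /existsNP[n1 H1] := none true; have /existsNP[n2 H2] := none false.
  have [n] := often (maxn n1 n2); rewrite geq_max => /andP[l1 l2] [[] nt].
    by apply: H1; exists n.
  by apply: H2; exists n.
have /card_gt0P[v0 v0I] := a0.
apply: (@copies_assembled R V F c col) => M.
pose C := (N0 + M * #|I|.+1)%N.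
have d0 : 0 < kappa - kappa1 by rewrite /kappa1; lra.
pose n0 := (Num.truncn (C%:R / (kappa - kappa1))).+1.
have [n] := colP (maxn M n0); rewrite geq_max => /andP[Mn n0n] nt.
have Cn : C%:R <= (kappa - kappa1) * n%:R.
  have /andP[_ lt3] := truncn_itv (divr_ge0 (ler0n R C) (ltW d0)).
  rewrite [leRHS]mulrC -ler_pdivrMr //; apply: le_trans (ltW lt3) _.
  by rewrite ler_nat.
have [E [cE uE ME cnt]] := copies_from_tiling I_dind c_sym k_lt classes M v0 b0 nt.
have cnt' : (1 - kappa) * n%:R <= (count (mem (verts E)) (iota 1 n))%:R.
  by move: cnt; rewrite natrD -/C; lra.
exists n, E; split => //; split => //.
apply: contraTneq cnt' => ->; rewrite /verts /= -ltNge.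
have -> : count (mem [::]) (iota 1 n) = 0%N by rewrite (eq_count (a2 := pred0)) ?count_pred0.
by rewrite mulr_gt0 ?subr_gt0 // ltr0n; apply: leq_trans n0n.
Qed.

End MainBound.

Theorem theorem8 (R : realType) (V : finType) (F : sgraph V) (I : {set V})
    (F_connected : connected_graph F)
    (I_nonempty : I != finset.set0)
    (I_doubly_independent : doubly_independent F I) :
  ((f (#|nbhd F I|%:R / #|I|%:R : R)%:E)%:E
     <= ramsey_upper_density R (omega_copies F))%E.
Proof.
have a0 : (0 < #|I|)%N by rewrite card_gt0.
have [indI _] := I_doubly_independent.
(* By connectedness, [I] without neighbors is everything. *)
case: (posnP #|nbhd F I|) => [/cards0_eq N0|b0].
  have /card_gt0P[v0 v0I] := a0.
  have adjI u v : u \in I -> adj F u v -> False.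
    move=> uI uv; case: (boolP (v \in I)) => vI; first by have := indI _ _ uI vI; rewrite uv.
    have : v \in nbhd F I by rewrite !inE vI /=; apply/bigcupP; exists u; rewrite ?inE.
    by rewrite N0 inE.
  have allI v : v \in I.
    rewrite -(closed_connect _ (F_connected v0 v)) // => x y xy.
    apply/idP/idP => [/adjI/(_ xy)//|yI].
    by case: (adjI y x yI); rewrite adj_sym.
  rewrite N0 cards0 mul0r /f eqxx.
  by apply: (edgeless_density _ v0) => u v; apply/negP; apply: adjI.
pose lam : R := #|nbhd F I|%:R / #|I|%:R.
have lam0 : 0 < lam by rewrite divr_gt0 ?ltr0n.
rewrite -/lam /f gt_eqF //.
set D := _ + _ / _.
have gN1 : -1 < (lam - 1) / (lam + 1) by rewrite ltr_pdivlMr; lra.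
have g1 : (lam - 1) / (lam + 1) < 1 by rewrite ltr_pdivrMr; lra.
have l1 : 0 < 1 + lam by lra.
have hD : 2 * lam / (1 + lam) ^+ 2 * (h ((lam - 1) / (lam + 1)) + (1 + lam)) = D.
  by rewrite /D; field; rewrite !gt_eqF //; lra.
have D2 : 2 <= D.
  have h2 : (1 + lam) / lam <= h ((lam - 1) / (lam + 1)).
    apply: le_trans (h_ge gN1 g1); rewrite le_eqVlt; apply/orP; left; apply/eqP.
    by field; rewrite !gt_eqF //; lra.
  rewrite -hD; apply: (@le_trans _ _ (2 * lam / (1 + lam) ^+ 2 * ((1 + lam) / lam + (1 + lam)))).
    by rewrite le_eqVlt; apply/orP; left; apply/eqP; field; rewrite !gt_eqF.
  rewrite ler_wpM2l //; last by lra.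
  by rewrite divr_ge0 ?exprn_ge0 ?mulr_ge0 // ltW.
have D0 : 0 < D by lra.
have Di : 1 / D <= 1 / 2 by rewrite !div1r lef_pV2 ?posrE.
have Di0 : 0 < 1 / D by rewrite divr_gt0.
apply/lee_addgt0Pr => e e0.
(* The bound [1 / 4] keeps the loss [1 / D + d] below 1. *)
pose d := Num.min e (1 / 4).
have d0 : 0 < d by rewrite lt_min e0 /=; lra.
have de : d <= e by rewrite ge_min lexx.
have d4 : d <= 1 / 4 by rewrite ge_min lexx orbT.
apply: (@le_trans _ _ ((1 - (1 / D + d))%:E + e%:E)%E).
  by rewrite -EFinD lee_fin; lra.
apply: leeD => //; apply: ereal_sup_ubound.
exists (1 - (1 / D + d)) => // c c_sym.
apply: (@density_from_gap _ _ _ _ I_doubly_independent (1 / D + d / 2)) => //.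
- by apply/andP; split; lra.
- by lra.
have k0 : 0 < 1 / D + d / 2 by lra.
rewrite -/lam; set k := 1 / D + _ in k0 *.
have kD : 1 < k * D by rewrite -ltr_pdivrMr // /k; lra.
have lk0 : 0 < 2 * lam * k by rewrite mulr_gt0 // mulr_gt0.
rewrite ltrBlDr ltr_pdivrMr //.
have hD' : 2 * lam * (h ((lam - 1) / (lam + 1)) + (1 + lam)) = D * (1 + lam) ^+ 2.
  by rewrite -hD; field; rewrite gt_eqF.
have -> : (h ((lam - 1) / (lam + 1)) + (1 + lam)) * (2 * lam * k) = k * D * (1 + lam) ^+ 2.
  by rewrite -[RHS]mulrA -hD'; ring.
by rewrite -[ltLHS]mul1r ltr_pM2r // exprn_gt0.
Qed.
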